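(* Let $\mathbf H$ be a commutative and cocommutative connected Hopf monoid linearized in the basis $\mathbf h$, $I$ a finite set and $x,y\in\mathbf h[I]$ with $\mathcal C_x^y\ne\emptyset$. Then the coefficient $c_x^y$ of $y$ in the antipode $S_I(x)$ satisfies $$c_x^y=\sum_{\mathcal O\in\mathfrak O_x^y}(-1)^{\ell(A_{\mathcal O})},$$ where $\mathfrak O_x^y$ is the set of acyclic orientations of the hypergraph $G_x^y$ and $A_{\mathcal O}$ is the set composition associated to $\mathcal O$ as described below.
   Context: Work over a field of characteristic $0$. A connected Hopf monoid in vector species $\mathbf H$ has products $\mu_{A_1,A_2}$ and coproducts $\Delta_{A_1,A_2}$ for ordered decompositions $I=A_1\sqcup A_2$, satisfying associativity, coassociativity and compatibility axioms; commutative and cocommutative mean $\mu$ and $\Delta$ are invariant under swapping the two factors. It is linearized in the basis $\mathbf h$ if products send basis pairs to basis elements and coproducts send basis elements to $0$ or to a tensor of basis elements. A set composition $A=(A_1,\dots,A_k)\models I$ is a sequence of nonempty disjoint subsets with union $I$, $\ell(A)=k$; $\mu_A,\Delta_A$ are iterated product/coproduct; the antipode is $S_I=\sum_{A\models I}(-1)^{\ell(A)}\mu_A\Delta_A$. For $x\in\mathbf h[I]$ with $\Delta_A(x)\ne0$ put $x_A=\mu_A\Delta_A(x)$; $\mathcal C_x^y=\{A\models I:\Delta_A(x)\ne0,\ x_A=y\}$, and $c_x^y=\sum_{A\in\mathcal C_x^y}(-1)^{\ell(A)}$. Refinement: $A\le B$ if every part of $B$ is a union of consecutive parts of $A$. Fix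 a minimal element $\Lambda=(\Lambda_1,\dots,\Lambda_m)$ of $\mathcal C_x^y$. For $P\subseteq I$ a union of parts of $\Lambda$ write $\Delta_{P,I\setminus P}(x)=x_P\otimes x_{I\setminus P}$. The hypergraph $G_x^y$ on $V=[m]$ has as hyperedges exactly the $U\subseteq[m]$ with $\prod_{i\in U}x_{\Lambda_i}\ne x_{\bigcup_{i\in U}\Lambda_i}$ and $\prod_{i\in P}x_{\Lambda_i}=x_{\bigcup_{i\in P}\Lambda_i}$ for every nonempty proper $P\subsetneq U$. An orientation of a hyperedge $U$ is a pair $(\mathfrak a,\mathfrak b)$ of nonempty disjoint sets with $\mathfrak a\cup\mathfrak b=U$ ($\mathfrak a$ the head); an orientation $\mathcal O$ of $G_x^y$ orients every hyperedge. $V/\mathcal O$ is the set partition of $V$ generated by $a\sim a'$ whenever $a,a'$ lie in a common head. $G/\mathcal O$ is the oriented graph on $V/\mathcal O$ with an arc $([a],[b])$ iff some $(\mathfrak a,\mathfrak b)\in\mathcal O$ has $a\in\mathfrak a$, $b\in\mathfrak b$; $\mathcal O$ is acyclic if $G/\mathcal O$ has no directed cycles (including loops). For acyclic $\mathcal O$, $A_{\mathcal O}=(A_1,\dots,A_\ell)$ is the ordering of the blocks of $V/\mathcal O$ such that for each $i$, $A_i$ is the source (vertex with no incoming arc) of the restriction of $G/\mathcal O$ to $A_i\cup\dots\cup A_\ell$ having the largest minimum element among all sources; thus $\ell(A_{\mathcal O})=|V/\mathcal O|$. *)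

(* Defs.v *)
From HB Require Import structures.
From mathcomp Require Import all_boot all_order all_algebra.
From mathcomp Require Import finmap.
From mathcomp.multinomials Require Import monalg.

Set Implicit Arguments.
Unset Strict Implicit.
Unset Printing Implicit Defensive.

Import GRing.Theory.

Local Open Scope fset_scope.
Local Open Scope ring_scope.

(* The vector space with basis T is {malg K[T]}; the tensor product of the    *)
(* spaces with bases S and T is the space with basis S * T.                   *)
Section Tensor.
Variable K : fieldType.

Definition linext (T : choiceType) (V : lmodType K) (f : T -> V)
  (v : {malg K[T]}) : V := \sum_(t <- msupp v) v@_t *: f t.

Definition tens (S T : choiceType) (v : {malg K[S]}) (w : {malg K[T]}) :
  {malg K[(S * T)%type]} :=
  \sum_(s <- msupp v) \sum_(t <- msupp w) << v@_s * w@_t *g (s, t) >>.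

Definition tmap (S T S' T' : choiceType) (f : {malg K[S]} -> {malg K[S']})
  (g : {malg K[T]} -> {malg K[T']}) :
  {malg K[(S * T)%type]} -> {malg K[(S' * T')%type]} :=
  linext (fun p => tens (f << p.1 >>) (g << p.2 >>)).

Definition tassoc (S T W : choiceType) :
  {malg K[((S * T) * W)%type]} -> {malg K[(S * (T * W))%type]} :=
  linext (fun p => << (p.1.1, (p.1.2, p.2)) >>).

Definition tswap (S T : choiceType) :
  {malg K[(S * T)%type]} -> {malg K[(T * S)%type]} :=
  linext (fun p => << (p.2, p.1) >>).

Definition tswap_mid (S T S' T' : choiceType) :
  {malg K[((S * T) * (S' * T'))%type]} -> {malg K[((S * S') * (T * T'))%type]} :=
  linext (fun p => << ((p.1.1, p.2.1), (p.1.2, p.2.2)) >>).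

Lemma linextU (T : choiceType) (V : lmodType K) (f : T -> V) t :
  linext f << t >> = f t.
Proof. by rewrite /linext msuppU oner_eq0 big_seq_fset1 mcoeffUU scale1r. Qed.

Lemma tensU (S T : choiceType) (s : S) (t : T) :
  tens << s >> << t >> = << (s, t) >>.
Proof.
by rewrite /tens !msuppU oner_eq0 !big_seq_fset1 !mcoeffUU mulr1.
Qed.

End Tensor.

Definition decomp (U : choiceType) (I A B : {fset U}) : bool :=
  (A `|` B == I) && [disjoint A & B]%fset.

(* Finite sets are the finite subsets of a type U, which is arbitrary. The    *)
(* spaces H[I] come with a basis. Only the values of sp_map at bijections     *)
(* are meaningful.                                                            *)
Record vspecies (K : fieldType) (U : choiceType) := VSpecies {
  basis : {fset U} -> choiceType;
  sp_map : forall A B : {fset U},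
    (A -> B) -> {linear {malg K[basis A]} -> {malg K[basis B]}};
  sp_map_ext : forall (A B : {fset U}) (f g : A -> B),
    f =1 g -> sp_map f =1 sp_map g;
  sp_map_id : forall A : {fset U}, sp_map (@id A) =1 id;
  sp_map_comp : forall (A B C : {fset U}) (f : A -> B) (g : B -> C),
    bijective f -> bijective g -> sp_map (g \o f) =1 sp_map g \o sp_map f
}.

(* mu I A B and Delta I A B are meaningful only when I is the disjoint union  *)
(* of A and B; carrying I, A and B separately avoids casts along equalities   *)
(* of finite sets. hunit I (the image of 1) and hcounit I are the components  *)
(* of the unit 1 -> H and of the counit H -> 1, where 1 is the species which  *)
(* is K on the empty set and 0 elsewhere.                                     *)
Record hopf_monoid (K : fieldType) (U : choiceType) := HopfMonoid {
  hspecies :> vspecies K U;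
  mu : forall I A B : {fset U},
    {linear {malg K[(basis hspecies A * basis hspecies B)%type]} ->
            {malg K[basis hspecies I]}};
  Delta : forall I A B : {fset U},
    {linear {malg K[basis hspecies I]} ->
            {malg K[(basis hspecies A * basis hspecies B)%type]}};
  hunit : forall I : {fset U}, {malg K[basis hspecies I]};
  hcounit : forall I : {fset U}, {scalar {malg K[basis hspecies I]}};

  hunit_eq0 : forall I : {fset U}, I != fset0 -> hunit I = 0;
  hcounit_eq0 : forall I : {fset U}, I != fset0 -> hcounit I =1 (fun=> 0);
  (* connectedness: the unit and counit identify H[fset0] with K *)
  hunitK : hcounit fset0 (hunit fset0) = 1;
  hcounitK : forall v, hcounit fset0 v *: hunit fset0 = v;

  mu_natural : forall (I A B I' A' B' : {fset U})
      (s : I -> I') (a : A -> A') (b : B -> B')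
      (v : {malg K[basis hspecies A]}) (w : {malg K[basis hspecies B]}),
    decomp I A B -> decomp I' A' B' ->
    bijective s -> bijective a -> bijective b ->
    (forall i j, fsval i = fsval j -> fsval (s i) = fsval (a j)) ->
    (forall i j, fsval i = fsval j -> fsval (s i) = fsval (b j)) ->
    sp_map hspecies s (mu I A B (tens v w)) =
    mu I' A' B' (tens (sp_map hspecies a v) (sp_map hspecies b w));
  Delta_natural : forall (I A B I' A' B' : {fset U})
      (s : I -> I') (a : A -> A') (b : B -> B') (v : {malg K[basis hspecies I]}),
    decomp I A B -> decomp I' A' B' ->
    bijective s -> bijective a -> bijective b ->
    (forall i j, fsval i = fsval j -> fsval (s i) = fsval (a j)) ->
    (forall i j, fsval i = fsval j -> fsval (s i) = fsval (b j)) ->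
    Delta I' A' B' (sp_map hspecies s v) =
    tmap (sp_map hspecies a) (sp_map hspecies b) (Delta I A B v);

  mu_unitl : forall (I : {fset U}) (v : {malg K[basis hspecies I]}),
    mu I fset0 I (tens (hunit fset0) v) = v;
  mu_unitr : forall (I : {fset U}) (v : {malg K[basis hspecies I]}),
    mu I I fset0 (tens v (hunit fset0)) = v;
  Delta_counitl : forall (I : {fset U}) (v : {malg K[basis hspecies I]}),
    linext (fun p => hcounit fset0 << p.1 >> *: << p.2 >>) (Delta I fset0 I v)
    = v;
  Delta_counitr : forall (I : {fset U}) (v : {malg K[basis hspecies I]}),
    linext (fun p => hcounit fset0 << p.2 >> *: << p.1 >>) (Delta I I fset0 v)
    = v;

  mu_assoc : forall (I A B C AB BC : {fset U}) (u : {malg K[basis hspecies A]})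
      (v : {malg K[basis hspecies B]}) (w : {malg K[basis hspecies C]}),
    decomp AB A B -> decomp I AB C -> decomp BC B C -> decomp I A BC ->
    mu I AB C (tens (mu AB A B (tens u v)) w) =
    mu I A BC (tens u (mu BC B C (tens v w)));
  Delta_coassoc : forall (I A B C AB BC : {fset U})
      (v : {malg K[basis hspecies I]}),
    decomp AB A B -> decomp I AB C -> decomp BC B C -> decomp I A BC ->
    tassoc (tmap (Delta AB A B) id (Delta I AB C v)) =
    tmap id (Delta BC B C) (Delta I A BC v);
  mu_Delta_compat : forall (I S T P Q : {fset U})
      (v : {malg K[basis hspecies S]}) (w : {malg K[basis hspecies T]}),
    decomp I S T -> decomp I P Q ->
    Delta I P Q (mu I S T (tens v w)) =
    tmap (mu P (S `&` P) (T `&` P)) (mu Q (S `&` Q) (T `&` Q))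
      (tswap_mid (tens (Delta S (S `&` P) (S `&` Q) v)
                       (Delta T (T `&` P) (T `&` Q) w)))
}.

Section SetCompositions.
Variable U : choiceType.

Definition cup (s : seq {fset U}) : {fset U} := \bigcup_(A <- s) A.

Definition setcomp (I : {fset U}) (s : seq {fset U}) : bool :=
  [&& all (fun A => A != fset0) s,
      pairwise (fun A B : {fset U} => [disjoint A & B]%fset) s & cup s == I].

(* A set composition of I has at most #|I| parts. *)
Definition setcomps (I : {fset U}) : {fset seq {fset U}} :=
  [fset s in flatten [seq [seq [seq val A | A <- tval t]
                          | t : k.-tuple (fpowerset I)]
                     | k <- iota 0 #|` I|.+1]
  | setcomp I s].

(* refines A B is A <= B: the sequence A is cut into consecutive stretches,   *)
(* whose unions are the successive parts of B.                                *)
Definition refines (A B : seq {fset U}) : Prop :=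
  exists ss : seq (seq {fset U}), flatten ss = A /\ [seq cup s | s <- ss] = B.

Lemma in_setcomps (I : {fset U}) s : (s \in setcomps I) = setcomp I s.
Proof.
rewrite !inE; apply/andb_idl => compIs.
have /and3P[/allP nz djs /eqP cupI] := compIs.
have subI A : A \in s -> A `<=` I.
  by move=> As; rewrite -cupI /cup; apply: bigfcup_sup.
have szs : (size s <= #|` I|)%N.
  rewrite -cupI /cup; elim: s nz djs {compIs cupI subI} => //= A s IHs nz.
  case/andP=> /allP djA djs.
  rewrite big_cons cardfsU.
  have -> : A `&` \bigcup_(B <- s) B = fset0.
    apply/eqP/fset0Pn=> -[u]; rewrite inE => /andP[uA /bigfcupP[B]].
    by rewrite andbT => /djA /fdisjointP/(_ _ uA)/negP.
  rewrite cardfs0 subn0 -add1n leq_add ?IHs //.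
    by rewrite cardfs_gt0 nz ?mem_head.
  by move=> B Bs; rewrite nz // inE Bs orbT.
apply/flattenP; exists [seq [seq val A | A <- tval t]
                       | t : (size s).-tuple (fpowerset I)].
  by apply/mapP; exists (size s); rewrite ?mem_iota.
have [t tE] : exists t : seq (fpowerset I), map val t = s.
  elim: s subI {nz djs cupI compIs szs} => [|A s IHs] subI; first by exists [::].
  have [|t <-] := IHs; first by move=> B Bs; apply: subI; rewrite inE Bs orbT.
  have AI : A \in fpowerset I by rewrite fpowersetE subI ?mem_head.
  by exists ([` AI] :: t).
have st : size t == size s by rewrite -tE size_map.
by apply/imageP; exists (Tuple st).
Qed.

End SetCompositions.

Section HopfMonoid.
Variables (K : fieldType) (U : choiceType) (H : hopf_monoid K U).

Definition commutative_hopf : Prop :=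
  forall (I A B : {fset U}) (v : {malg K[basis H A]}) (w : {malg K[basis H B]}),
    decomp I A B -> mu H I A B (tens v w) = mu H I B A (tens w v).

Definition cocommutative_hopf : Prop :=
  forall (I A B : {fset U}) (v : {malg K[basis H I]}),
    decomp I A B -> Delta H I B A v = tswap (Delta H I A B v).

Definition linearized : Prop :=
  (forall (I A B : {fset U}) (a : basis H A) (b : basis H B), decomp I A B ->
     exists c : basis H I, mu H I A B (tens << a >> << b >>) = << c >>) /\
  (forall (I A B : {fset U}) (c : basis H I), decomp I A B ->
     Delta H I A B << c >> = 0 \/
     exists (a : basis H A) (b : basis H B),
       Delta H I A B << c >> = tens << a >> << b >>).

(* The basis of H[A_1] (x) ... (x) H[A_k]. *)
Fixpoint basis_seq (s : seq {fset U}) : choiceType :=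
  if s is A :: s' then (basis H A * basis_seq s')%type else unit.

(* For s = [:: A] these are the identity of H[A], by (co)unitality. *)
Fixpoint Delta_seq (s : seq {fset U}) :
    forall I, {malg K[basis H I]} -> {malg K[basis_seq s]} :=
  match s return forall I, {malg K[basis H I]} -> {malg K[basis_seq s]} with
  | [::] => fun I v => << hcounit H I v *g tt >>
  | A :: s' => fun I v =>
      tmap id (@Delta_seq s' (cup s')) (Delta H I A (cup s') v)
  end.

Fixpoint mu_seq (s : seq {fset U}) :
    forall I, {malg K[basis_seq s]} -> {malg K[basis H I]} :=
  match s return forall I, {malg K[basis_seq s]} -> {malg K[basis H I]} with
  | [::] => fun I v => v@_tt *: hunit H I
  | A :: s' => fun I v =>
      mu H I A (cup s') (tmap id (@mu_seq s' (cup s')) v)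
  end.

Fixpoint tens_seq (f : forall A, {malg K[basis H A]}) (s : seq {fset U}) :
    {malg K[basis_seq s]} :=
  if s is A :: s' then tens (f A) (tens_seq f s') else << tt >>.

Definition antipode (I : {fset U}) (v : {malg K[basis H I]}) :
    {malg K[basis H I]} :=
  \sum_(s <- setcomps I) (-1) ^+ size s *: mu_seq I (Delta_seq s v).

Definition compset (I : {fset U}) (x y : basis H I) : {fset seq {fset U}} :=
  [fset s in setcomps I | (Delta_seq s << x >> != 0) &&
                          (mu_seq I (Delta_seq s << x >>) == << y >>)].

Definition coef (I : {fset U}) (x y : basis H I) : int :=
  \sum_(s <- compset x y) (-1) ^+ size s.

Definition minimal_comp (I : {fset U}) (x y : basis H I) (L : seq {fset U}) :
    Prop :=
  L \in compset x y /\
  forall B, B \in compset x y -> refines B L -> B = L.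

(* x_P as an element of H[P]: if Delta I P (I `\` P) << x >> = << (a, b) >>,  *)
(* its image under << (a, b) >> |-> << a >>.                                  *)
Definition restr (I : {fset U}) (x : basis H I) (P : {fset U}) :
    {malg K[basis H P]} :=
  linext (fun p => << p.1 >>) (Delta H I P (I `\` P) << x >>).

Section Hypergraph.
Variables (I : {fset U}) (x : basis H I) (L : seq {fset U}).
Local Notation V := 'I_(size L).

Definition parts (W : {set V}) : seq {fset U} :=
  [seq nth fset0 L i | i : V <- enum W].

(* The product of the x_(L_i), i in W, equals x_(union of the L_i, i in W);    *)
(* the left-hand side is taken in the increasing order of i.                  *)
Definition splits (W : {set V}) : bool :=
  mu_seq (cup (parts W)) (tens_seq (restr x) (parts W))
    == restr x (cup (parts W)).

Definition hyperedges : {set {set V}} :=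
  [set W | ~~ splits W &
           [forall P : {set V}, (P != set0) && (P \proper W) ==> splits P]].

End Hypergraph.

End HopfMonoid.

(* Orientations of a hypergraph E. An orientation is the set of its pairs     *)
(* (head, tail).                                                              *)
Section Orientation.
Variable n : nat.
Local Notation V := 'I_n.
Implicit Types (E : {set {set V}}) (O : {set {set V} * {set V}}).
Implicit Types (B C : {set V}) (R : {set {set V}}).

Definition orientation E O : bool :=
  [forall o in O, [&& o.1 != set0, o.2 != set0, [disjoint o.1 & o.2]
                    & o.1 :|: o.2 \in E]] &&
  [forall W in E, #|[set o in O | o.1 :|: o.2 == W]| == 1%N].

Definition same_head O : rel V :=
  [rel a a' | [exists o in O, (a \in o.1) && (a' \in o.1)]].

Definition blocks O : {set {set V}} :=
  equivalence_partition (connect (same_head O)) [set: V].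

Definition arc O : rel {set V} :=
  [rel B C | [&& B \in blocks O, C \in blocks O &
     [exists o in O, [exists a in B, a \in o.1] && [exists b in C, b \in o.2]]]].

Definition acyclic O : bool :=
  [forall B, forall C, arc O B C ==> ~~ connect (arc O) C B].

Definition acyclic_orientations E : {set {set {set V} * {set V}}} :=
  [set O | orientation E O && acyclic O].

Definition sources O R : {set {set V}} :=
  [set B in R | [forall C in R, ~~ arc O C B]].

(* The minimum element of a nonempty B. *)
Definition minelt B : nat := \big[minn/n]_(i in B) i.

Fixpoint ordering O (k : nat) R : seq {set V} :=
  if k is k'.+1 then
    if [pick B in sources O R |
          [forall C in sources O R, minelt C <= minelt B]%N] is Some B
    then B :: ordering O k' (R :\ B) else [::]
  else [::].

Definition comp_of O : seq {set V} := ordering O #|blocks O| (blocks O).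

Lemma acyclicP O :
  reflect (forall s : seq {set V}, s != [::] -> ~~ cycle (arc O) s)
          (acyclic O).
Proof.
apply: (iffP 'forall_forallP) => [acO | acO B C].
  case=> [//|B s] _; apply/negP; case: s => [|C s] /=.
    by rewrite andbT => BB; have /implyP/(_ BB) := acO B B; rewrite connect0.
  case/andP=> BC Cs; have /implyP/(_ BC)/negP := acO B C; apply.
  by apply/connectP; exists (rcons s B); rewrite ?last_rcons.
apply/implyP=> BC; apply/negP=> /connectP[p Cp lastp].
move/negP: (acO (C :: p) isT); apply => /=.
by rewrite rcons_path Cp -lastp.
Qed.

End Orientation.

(* Main.v *)
Require Import Defs.
From HB Require Import structures.
From mathcomp Require Import all_boot all_order all_algebra.
From mathcomp Require Import finmap.
From mathcomp.multinomials Require Import monalg.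

Set Implicit Arguments.
Unset Strict Implicit.
Unset Printing Implicit Defensive.

Import GRing.Theory.

Local Open Scope ring_scope.

(* Write x_s for the product of the restrictions of x to the parts of s. If s *)
(* lies in C_x^y and S is a part of the minimal composition Lam, then cutting *)
(* y = x_s along a part P of s and comparing with y = x_Lam shows that x_S is *)
(* the product of its restrictions to the intersection and the difference of  *)
(* S and P; by minimality one of these two sets is empty. Hence the elements  *)
(* of C_x^y are coarsenings of reorderings of Lam, that is, set compositions  *)
(* of the index set V of Lam. As the coproduct inverts the product on pure    *)
(* tensors, such a composition lies in C_x^y iff x splits on each of its      *)
(* blocks, iff no block contains a hyperedge.                                 *)
(* A composition of V none of whose blocks contains a hyperedge orients each  *)
(* hyperedge W, the head being the intersection of W with the first block     *)
(* meeting W; this orientation is acyclic. For a fixed acyclic O, the         *)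
(* compositions inducing O are the strictly order-preserving surjections of   *)
(* V/O onto chains, and their signed count is (-1)^|V/O|: the first block is  *)
(* a nonempty union of sources, so by induction the count reduces to the      *)
(* alternating sum over the nonempty sets of sources.                         *)

(** Both sides equal one signed count: that of the set compositions of V none of whose blocks
    contains a hyperedge. The algebraic half, [coef_scomps], identifies C_x^y with these
    compositions. [part_sub_or_disjoint] turns minimality of Lam into the statement that every
    member of C_x^y is glued from parts of Lam. [mprod_lam] reduces membership to splitting on each
    block, because a product of basis elements determines its factors ([mu_tens_inj]). [splitsP]
    turns splitting into avoidance of hyperedges, because splitting passes to subsets
    ([splits_sub]). The combinatorial half, [sum_acyclic_orientations], holds for every hypergraph
    without an empty hyperedge. Compositions are sorted by the orientation that they induce
    ([compat_orient]), and [sum_compat_cover] evaluates each class by removing sets of sources, all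
    cancellation coming from [alternating_sum_subsets]. *)

Section Compositions.
Variable T : finType.
Implicit Types (R D : {set T}) (B : seq {set T}).

Lemma mem_bigcup_seq B u :
  (u \in \bigcup_(D <- B) D) = has (fun D : {set T} => u \in D) B.
Proof. by elim: B => [|D B IHB]; rewrite ?big_nil ?big_cons inE //= IHB. Qed.

(** The blocks are peeled off from the front, which is the shape on which the signed counts recurse;
    [scompE] gives the usual description. *)
Fixpoint scomp R B : bool :=
  if B is D :: B' then [&& D != set0, D \subset R & scomp (R :\: D) B']
  else R == set0.

Lemma scompE R B : scomp R B =
  [&& all (fun D => D != set0) B,
      pairwise (fun D D' : {set T} => [disjoint D & D']) B &
      \bigcup_(D <- B) D == R].
Proof.
elim: B R => [|D B IHB] R /=; first by rewrite big_nil eq_sym.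
rewrite IHB big_cons -!andbA; case: (D != set0) => //=.
have disjE : all (fun D' : {set T} => [disjoint D & D']) B =
    [disjoint D & \bigcup_(D' <- B) D'].
  elim: B {IHB} => [|D' B IHB] /=; first by rewrite big_nil disjoints_subset setC0 subsetT.
  by rewrite big_cons IHB !(disjoint_sym D) -!setI_eq0 setIUl setU_eq0.
rewrite disjE; case: (all _ B); rewrite ?andbF //=.
case: (pairwise _ B); rewrite ?andbF //=.
apply/andP/andP=> [[sDR /eqP BE]|[dDB /eqP<-]].
  rewrite BE; split; first by rewrite disjoints_subset setCD subsetUr.
  apply/eqP/setP=> u; rewrite !inE.
  by have [/(subsetP sDR)|] := boolP (u \in D).
rewrite subsetUl setDUl setDv set0U; split=> //.
by apply/eqP/esym/setDidPl; rewrite disjoint_sym.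
Qed.

(** The fuel [k] need only bound [#|R|], since each nonempty block removes an element. *)
Fixpoint scomps_rec k R : seq (seq {set T}) :=
  if R == set0 then [:: [::]] else
  if k is k'.+1 then
    [seq D :: B | D <- enum [pred D | (D != set0) && (D \subset R)],
                  B <- scomps_rec k' (R :\: D)]
  else [::].

Definition scomps R := scomps_rec #|R| R.

Lemma card_setD_scomp R D k : D != set0 -> D \subset R -> (#|R| <= k.+1)%N ->
  (#|R :\: D| <= k)%N.
Proof.
move=> D0 sDR; rewrite cardsD (setIidPr sDR); move: D0; rewrite -card_gt0.
by case: #|D| => // n _; rewrite leq_subLR addSn => /leq_trans-> //; rewrite ltnS leq_addl.
Qed.

Lemma mem_scomps_rec k R B : (#|R| <= k)%N -> (B \in scomps_rec k R) = scomp R B.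
Proof.
elim: k R B => [|k IHk] R B kR /=.
  move: kR; rewrite leqn0 cards_eq0 => /eqP->; rewrite eqxx inE.
  case: B => [|D B] /=; first by rewrite !eqxx.
  by rewrite subset0; case: (D == set0).
case: eqVneq => [-> | R0].
  rewrite inE; case: B => [|D B] /=; first by rewrite !eqxx.
  by rewrite subset0; case: (D == set0).
apply/allpairsPdep/idP => [[D [B' [+ + ->]]] | ].
  rewrite mem_enum inE => /andP[D0 sDR].
  by rewrite IHk ?(card_setD_scomp D0 sDR) //= D0 sDR.
case: B => [|D B] /=; first by rewrite (negPf R0).
case/and3P=> D0 sDR BE; exists D, B; rewrite mem_enum inE D0 sDR IHk //.
exact: card_setD_scomp kR.
Qed.

Lemma mem_scomps R B : (B \in scomps R) = scomp R B.
Proof. exact: mem_scomps_rec. Qed.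

Lemma scomps_rec_uniq k R : uniq (scomps_rec k R).
Proof.
elim: k R => [|k IHk] R /=; case: ifP => // _.
apply: allpairs_uniq_dep => [|D _|[D B] [D' B'] _ _ /= [<- <-] //].
  exact: enum_uniq.
exact: IHk.
Qed.

Lemma scomps_uniq R : uniq (scomps R).
Proof. exact: scomps_rec_uniq. Qed.

Lemma big_scomps (V : nmodType) (F : seq {set T} -> V) R : R != set0 ->
  \sum_(B <- scomps R) F B =
  \sum_(D : {set T} | (D != set0) && (D \subset R))
    \sum_(B <- scomps (R :\: D)) F (D :: B).
Proof.
move=> R0; have [k kE] : exists k, #|R| = k.+1.
  by case: #|R| (cards_eq0 R) => [|k _]; [rewrite (negPf R0) | exists k].
rewrite {1}/scomps kE /= (negPf R0) big_allpairs_dep /= big_enum /=.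
apply: eq_bigr => D /andP[D0 sDR].
(* The recursive call has fuel [k] where [scomps] uses [#|R :\: D|]; both lists are duplicate-free
   with the same members. *)
apply: perm_big; apply: uniq_perm; try exact: scomps_rec_uniq.
by move=> B; rewrite mem_scomps mem_scomps_rec // (card_setD_scomp D0 sDR) ?kE.
Qed.

End Compositions.

(** * Signed count of the compositions that induce a given acyclic orientation *)

Section AcyclicOrientations.
Variable n : nat.
Local Notation V := 'I_n.
Local Notation arc := Defs.arc.
Implicit Types (E : {set {set V}}) (O : {set {set V} * {set V}}).
Implicit Types (C D R W : {set V}) (F X : {set {set V}}) (B : seq {set V}).

(** Toggling a fixed element of [Y] is a sign-reversing involution on its subsets, so the sum equals
    its own opposite. *)
Lemma alternating_sum_subsets (T : finType) (Y : {set T}) : Y != set0 ->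
  \sum_(X : {set T} | X \subset Y) (-1) ^+ #|X| = 0 :> int.
Proof.
case/set0Pn=> y yY; set s := LHS; suff sN : s = - s.
  by move/eqP: sN; rewrite -addr_eq0 -mulr2n Num.Theory.mulrn_eq0 => /eqP.
pose toggle (X : {set T}) := if y \in X then X :\ y else y |: X.
have toggleK : involutive toggle.
  move=> X; rewrite /toggle; have [yX|yX] := boolP (y \in X).
    by rewrite setD11 setD1K.
  by rewrite setU11 setU1K.
rewrite {1}/s (reindex_inj (can_inj toggleK)) -sumrN; apply: eq_big => [X|X _].
  rewrite /toggle; case: ifP => [yX|_]; last by rewrite subUset sub1set yY.
  by rewrite -[in RHS](setD1K yX) subUset sub1set yY.
rewrite /toggle; case: ifP => yX; last by rewrite cardsU1 yX exprS mulN1r.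
by rewrite [in RHS](cardsD1 y X) yX exprS mulN1r opprK.
Qed.

Section Blocks.
Variable O : {set {set V} * {set V}}.

Definition block_of (u : V) := [set v | connect (same_head O) u v].

Let csym : connect_sym (same_head O).
Proof.
apply: sym_connect_sym => a b; apply: eq_existsb => o.
by rewrite /= [(a \in _) && _]andbC.
Qed.

Lemma mem_bl u : u \in block_of u.
Proof. by rewrite inE connect0. Qed.

Lemma bl_blocks u : block_of u \in blocks O.
Proof. by apply/imsetP; exists u => //; apply/setP=> v; rewrite !inE. Qed.

Lemma blocks_bl C u : C \in blocks O -> u \in C -> C = block_of u.
Proof.
case/imsetP=> w _ ->; rewrite !inE /= => wu; apply/setP=> v; rewrite !inE /=.
exact: (same_connect csym wu).
Qed.

Lemma blocks_neq0 C : C \in blocks O -> exists u, C = block_of u.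
Proof. by case/imsetP=> w _ ->; exists w; apply/setP=> v; rewrite !inE. Qed.

Lemma mem_coverE F u : F \subset blocks O -> (u \in cover F) = (block_of u \in F).
Proof.
move/subsetP=> sF; apply/bigcupP/idP => [[C CF uC]|uF].
  by rewrite -(blocks_bl (sF _ CF) uC).
by exists (block_of u); rewrite ?mem_bl.
Qed.

Lemma bl_head o a a' : o \in O -> a \in o.1 -> a' \in o.1 -> block_of a = block_of a'.
Proof.
move=> oO ao a'o; apply: blocks_bl; first exact: bl_blocks.
by rewrite inE; apply: connect1; apply/exists_inP; exists o => //; rewrite ao.
Qed.

Lemma arcI o a b : o \in O -> a \in o.1 -> b \in o.2 -> arc O (block_of a) (block_of b).
Proof.
move=> oO ao bo; apply/and3P; split; rewrite ?bl_blocks //.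
apply/exists_inP; exists o => //.
by apply/andP; split; apply/exists_inP; [exists a | exists b]; rewrite ?mem_bl.
Qed.

Lemma arcE C D : arc O C D ->
  exists o a b, [/\ o \in O, a \in o.1, b \in o.2, C = block_of a & D = block_of b].
Proof.
case/and3P=> CO DO /exists_inP[o oO /andP[/exists_inP[a aC ao] /exists_inP[b bD bo]]].
by exists o, a, b; split=> //; apply: blocks_bl.
Qed.

Hypothesis acO : acyclic O.

(** A member of [F] with the fewest ancestors is a source: a predecessor in [F] would have strictly
    fewer, acyclicity excluding the member itself from them. *)
Lemma sources_neq0 F : F \subset blocks O -> F != set0 -> sources O F != set0.
Proof.
move=> sF /set0Pn[C0 C0F].
pose pre C := [set D | connect (arc O) D C].
have [C CF minC] := @arg_minnP _ C0 (fun C => C \in F) (fun C => #|pre C|) C0F.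
apply/set0Pn; exists C; rewrite inE CF; apply/forall_inP=> D DF.
apply/negP=> DC; have := minC D DF; rewrite leqNgt => /negP[].
apply: proper_card; apply/properP; split.
  by apply/subsetP=> D'; rewrite !inE => /connect_trans; apply; apply: connect1.
exists C; rewrite !inE ?connect0 //.
by have /forallP/(_ D)/forallP/(_ C)/implyP/(_ DC) := acO.
Qed.

(** Only the length of A_O matters for the sign; whichever source the tie-breaking rule selects, one
    exists at each stage and one block is removed. *)
Lemma size_comp_of : size (comp_of O) = #|blocks O|.
Proof.
suff sizeF k F : F \subset blocks O -> #|F| = k -> size (ordering O k F) = k.
  exact: sizeF.
elim: k F => //= k IHk F sF cF.
case: pickP => [C /andP[CF _] | none] /=.
  move: CF; rewrite inE => /andP[CF _]; rewrite IHk //.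
    by rewrite (subset_trans (subsetDl _ _)).
  by move: cF; rewrite (cardsD1 C F) CF => -[].
have /set0Pn[C0 C0s] : sources O F != set0.
  by apply: sources_neq0 => //; rewrite -card_gt0 cF.
have [C Cs maxC] := @arg_maxnP _ C0 (fun C => C \in sources O F) (@minelt n) C0s.
by have /negP[] := none C; rewrite Cs; apply/forall_inP.
Qed.

End Blocks.

Definition first B W := nth set0 B (find (fun D => ~~ [disjoint D & W]) B).

Lemma first_cons D B W :
  first (D :: B) W = if [disjoint D & W] then first B W else D.
Proof. by rewrite /first /=; case: [disjoint D & W]. Qed.

Section Compatible.
Variables (E : {set {set V}}) (O : {set {set V} * {set V}}).
Hypotheses (orO : orientation E O) (acO : acyclic O).
Local Notation edge o := (o.1 :|: o.2).

Lemma orient_neq0 o : o \in O -> exists a b, a \in o.1 /\ b \in o.2.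
Proof.
case/andP: orO => /forall_inP or1 _ /or1/and4P[/set0Pn[a ao] /set0Pn[b bo] _ _].
by exists a, b.
Qed.

Lemma orient_disj o u : o \in O -> u \in o.1 -> u \in o.2 -> False.
Proof.
case/andP: orO => /forall_inP or1 _ /or1/and4P[_ _ d _] u1 u2.
by rewrite (disjointFr d u1) in u2.
Qed.

(** The condition that [B] induces [O] on the hyperedges lying inside [R]; [okfirst] is the share of
    this condition borne by the first block, which concerns only the hyperedges it meets. *)
Definition compat R B := [forall o in O, (edge o \subset R) ==>
  (first B (edge o) :&: edge o == o.1)].

Definition okfirst R D := [forall o in O, (edge o \subset R) ==>
  ~~ [disjoint D & edge o] ==> (D :&: edge o == o.1)].

Lemma compat_cons R D B :
  compat R (D :: B) = okfirst R D && compat (R :\: D) B.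
Proof.
apply/forall_inP/andP => [cDB | [/forall_inP ok /forall_inP cB] o oO].
  split; apply/forall_inP=> o /cDB; rewrite first_cons.
    by case: (edge o \subset R) => //=; case: ifP.
  rewrite subsetD disjoint_sym => /implyP h; apply/implyP=> /andP[/h].
  by case: ifP.
have := ok o oO; have := cB o oO; rewrite first_cons subsetD [in X in X -> _]disjoint_sym.
by case: (edge o \subset R) => //=; case: ifP.
Qed.

(** * Admissible first blocks are the unions of sources; [closedF] is the invariant kept while
    sources are removed *)

Section Layer.
Variable F : {set {set V}}.
Hypotheses (sF : F \subset blocks O).
Local Notation R := (cover F).
Hypothesis closedF : forall o, o \in O -> o.1 \subset R -> o.2 \subset R.

Lemma head_sub o a : o \in O -> a \in o.1 -> a \in R -> edge o \subset R.
Proof.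
move=> oO ao aR; rewrite subUset; have sR : o.1 \subset R; last first.
  by rewrite sR closedF.
apply/subsetP=> a' a'o; move: aR; rewrite !(mem_coverE (O := O)) //.
by rewrite (bl_head oO ao a'o).
Qed.

(** An admissible first block meeting a head meets its hyperedge exactly in that head, hence
    contains the whole head; this propagates along chains of overlapping heads. *)
Lemma okfirst_bl D u : D \subset R -> okfirst R D -> u \in D -> block_of O u \subset D.
Proof.
move=> sDR /forall_inP okD uD; apply/subsetP=> v; rewrite inE => /connectP[p].
elim: p u uD => [|w p IHp] u uD /=; first by move=> _ ->.
case/andP=> /exists_inP[o oO /andP[uo wo]] pw vE; apply: IHp vE => //.
have eR := head_sub oO uo (subsetP sDR _ uD).
have /implyP/(_ eR)/implyP := okD o oO.
have -> : ~~ [disjoint D & edge o].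
  by apply/pred0Pn; exists u; rewrite /= uD inE uo.
by move=> /(_ isT)/eqP/setP/(_ w); rewrite !inE wo => /andP[].
Qed.

(** A union of sources contains no tail element, as the corresponding head would give an arc into a
    source. It contains all or nothing of a head, since a head lies in a single block. *)
Lemma okfirst_cover X : X \subset sources O F -> okfirst R (cover X).
Proof.
move=> sX; have sXF : X \subset F.
  by apply/subsetP=> C /(subsetP sX); rewrite inE => /andP[].
have sXb := subset_trans sXF sF.
apply/forall_inP=> o oO; apply/implyP=> eR; apply/implyP=> meets.
have [a [b [ao bo]]] := orient_neq0 oO.
have no2 c : c \in o.2 -> c \notin cover X.
  move=> co; rewrite (mem_coverE _ sXb); apply/negP=> /(subsetP sX).
  rewrite inE => /andP[_ /forall_inP/(_ (block_of O a))]; rewrite (arcI oO ao co) => h.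
  suff : block_of O a \in F by move/h.
  by rewrite -mem_coverE //; apply: (subsetP eR); rewrite inE ao.
apply/eqP/setP=> u; rewrite !inE; apply/andP/idP => [[uX /orP[//|/no2]]|uo].
  by rewrite uX.
rewrite uo; split=> //; case/pred0Pn: meets => c /= /andP[cX]; rewrite inE.
case/orP=> [co|/no2]; last by rewrite cX.
by rewrite (mem_coverE _ sXb) (bl_head oO uo co) -mem_coverE.
Qed.

(** An arc into a block inside [D] comes from a hyperedge with a tail element in [D], whereas an
    admissible [D] meets that hyperedge only in its head. *)
Lemma sources_cover D : D \subset R -> okfirst R D ->
  [set C in F | C \subset D] \subset sources O F.
Proof.
move=> sDR /forall_inP okD; apply/subsetP=> C; rewrite !inE => /andP[CF sCD].
rewrite CF; apply/forall_inP=> C' C'F; apply/negP.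
case/arcE=> o [a [b [oO ao bo C'E CE]]].
have aR : a \in R by rewrite (mem_coverE _ sF) -C'E.
have eR := head_sub oO ao aR; have bD : b \in D.
  by apply: (subsetP sCD); rewrite CE mem_bl.
have /implyP/(_ eR)/implyP := okD o oO.
have -> : ~~ [disjoint D & edge o].
  by apply/pred0Pn; exists b; rewrite /= bD inE bo orbT.
move=> /(_ isT)/eqP/setP/(_ b); rewrite !inE bD bo orbT => /esym b1.
exact: (orient_disj oO b1 bo).
Qed.

Lemma cover_blocks_sub D : D \subset R -> okfirst R D ->
  cover [set C in F | C \subset D] = D.
Proof.
move=> sDR okD; apply/setP=> u; apply/bigcupP/idP => [[C]|uD].
  by rewrite inE => /andP[_ /subsetP sCD] /sCD.
exists (block_of O u); last exact: mem_bl.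
by rewrite inE -mem_coverE // (subsetP sDR) //= okfirst_bl.
Qed.

Lemma blocks_sub_cover X : X \subset F -> [set C in F | C \subset cover X] = X.
Proof.
move=> sX; apply/setP=> C; rewrite inE; apply/andP/idP => [[CF]|CX].
  have [u ->] := blocks_neq0 (subsetP sF _ CF).
  move/subsetP/(_ u (mem_bl O u)).
  by rewrite (mem_coverE _ (subset_trans sX sF)).
by rewrite (subsetP sX) // bigcup_sup.
Qed.

Lemma cover_setD X : X \subset F -> cover (F :\: X) = R :\: cover X.
Proof.
move=> sX; apply/setP=> u; rewrite inE !(mem_coverE (O := O)) ?inE //.
  exact: subset_trans sX sF.
exact: subset_trans (subsetDl _ _) sF.
Qed.

(** If a head stays while an element of its tail is removed, there is an arc into a removed block,
    which therefore was not a source. *)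
Lemma closed_setD X : X \subset sources O F ->
  forall o, o \in O -> o.1 \subset cover (F :\: X) -> o.2 \subset cover (F :\: X).
Proof.
move=> sX o oO; have sXF : X \subset F.
  by apply/subsetP=> C /(subsetP sX); rewrite inE => /andP[].
rewrite cover_setD // !subsetD => /andP[s1 _]; rewrite closedF //=.
have [a [_ [ao _]]] := orient_neq0 oO.
apply/pred0P=> b /=; apply/negP=> /andP[bo].
rewrite (mem_coverE _ (subset_trans sXF sF)) => /(subsetP sX).
rewrite inE => /andP[_ /forall_inP/(_ (block_of O a))]; rewrite (arcI oO ao bo) => h.
suff : block_of O a \in F by move/h.
by rewrite -mem_coverE // (subsetP s1).
Qed.

End Layer.

Lemma cover_eq0 F : F \subset blocks O -> (cover F == set0) = (F == set0).
Proof.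
move=> sF; apply/eqP/eqP => [cF0|->]; last by rewrite /cover big_set0.
apply/eqP; apply: contraTT isT => /set0Pn[C CF].
have [u CE] := blocks_neq0 (subsetP sF _ CF).
have : u \in cover F by rewrite (mem_coverE _ sF) -CE.
by rewrite cF0 inE.
Qed.

(** Induction on the number of blocks. A first block made of a nonempty set X of sources leaves the
    count for [F :\: X], so it contributes -(-1)^|F| (-1)^|X|, and the signs (-1)^|X| sum to -1 over
    nonempty X. *)
Lemma sum_compat_cover F : F \subset blocks O ->
  (forall o, o \in O -> o.1 \subset cover F -> o.2 \subset cover F) ->
  \sum_(B <- scomps (cover F) | compat (cover F) B) (-1) ^+ size B =
  (-1) ^+ #|F| :> int.
Proof.
have [k] := ubnP #|F|; elim: k F => // k IHk F leFk sF closedF.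
have [F0|F0] := eqVneq F set0.
  have c0 : cover F = set0 by rewrite F0 /cover big_set0.
  rewrite c0 F0 cards0 /scomps cards0 /= eqxx big_cons big_nil addr0.
  case: ifP => // /negP[]; apply/forall_inP=> o oO; apply/implyP.
  have [a [_ [ao _]]] := orient_neq0 oO.
  by move/subsetP/(_ a); rewrite !inE ao => /(_ isT).
rewrite big_mkcond big_scomps ?cover_eq0 //.
(* Splitting off the first block [D] costs a sign, and by [compat_cons] only the admissible [D]
   contribute. *)
transitivity (\sum_(D : {set V} | [&& D != set0, D \subset cover F &
    okfirst (cover F) D])
  - \sum_(B <- scomps (cover F :\: D) | compat (cover F :\: D) B)
      (-1) ^+ size B : int).
  rewrite [LHS](bigID (okfirst (cover F))) /= [X in _ + X]big1 ?addr0.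
    apply: eq_big => [D|D /andP[_ okD]]; first by rewrite andbA.
    rewrite -sumrN [RHS]big_mkcond; apply: eq_bigr => B _.
    by rewrite compat_cons okD /= exprS mulN1r.
  by move=> D /andP[_ okD]; rewrite big1 // => B _; rewrite compat_cons (negPf okD).
(* Admissible first blocks correspond to nonempty sets of sources, through [cover] and its
   inverse. *)
rewrite (reindex_onto cover (fun D => [set C in F | C \subset D])) /=; last first.
  by move=> D /and3P[_ sDR okD]; apply: cover_blocks_sub.
transitivity (\sum_(X : {set {set V}} | (X \subset sources O F) && (X != set0))
   - ((-1) ^+ #|F| * (-1) ^+ #|X|) : int).
  apply: eq_big => [X | X /andP[/and3P[X0 sXR okX] /eqP XE]].
    apply/andP/andP => [[/and3P[X0 sXR okX] /eqP XE]|[sX X0]].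
      have sX : X \subset sources O F by rewrite -XE; apply: sources_cover.
      split=> //; apply: contraNneq X0 => ->.
      by rewrite /cover big_set0.
    have sXF : X \subset F.
      by apply/subsetP=> C /(subsetP sX); rewrite inE => /andP[].
    rewrite cover_eq0 ?(subset_trans sXF) // X0 okfirst_cover // blocks_sub_cover //.
    split=> //; rewrite andbT; apply/subsetP=> u.
    rewrite !(mem_coverE (O := O)) ?(subset_trans sXF) //.
    exact: (subsetP sXF).
  have sX : X \subset sources O F by rewrite -XE; apply: sources_cover.
  have sXF : X \subset F.
    by apply/subsetP=> C /(subsetP sX); rewrite inE => /andP[].
  have {}X0 : X != set0 by apply: contraNneq X0 => ->; rewrite /cover big_set0.
  rewrite -cover_setD //; congr (- _); rewrite IHk.
  - rewrite -[in RHS](cardsID X F) (setIidPr sXF) exprD mulrAC -exprD addnn.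
    by rewrite -[(-1) ^+ _.*2]signr_odd odd_double mul1r.
  - rewrite ltnS in leFk; apply: leq_trans leFk.
    rewrite -(cardsID X F) (setIidPr sXF) -[ltnLHS]add0n ltn_add2r.
    by rewrite card_gt0.
  - exact: subset_trans (subsetDl _ _) sF.
  - exact: closed_setD.
rewrite sumrN -mulr_sumr.
(* The full alternating sum vanishes; its term at the empty set is 1, so the nonempty sets
   contribute -1. *)
have := alternating_sum_subsets (sources_neq0 acO sF F0).
rewrite (bigD1 set0) ?sub0set //= cards0 => /eqP.
by rewrite addr_eq0 => /eqP/esym/(congr1 -%R); rewrite opprK => ->; rewrite mulrN1 opprK.
Qed.

Lemma sum_compat :
  \sum_(B <- scomps [set: V] | compat [set: V] B) (-1) ^+ size B =
  (-1) ^+ #|blocks O| :> int.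
Proof.
have cT : cover (blocks O) = [set: V].
  by apply/setP=> u; rewrite (mem_coverE _ (subxx _)) bl_blocks inE.
rewrite -sum_compat_cover // cT // => o _ _; exact: subsetT.
Qed.

End Compatible.

(** * The orientation induced by a composition *)

Definition orient E B :=
  [set (first B W :&: W, W :\: first B W) | W in E].

Definition avoids E B :=
  all (fun D => [forall W in E, ~~ (W \subset D)]) B.

Lemma scomp_has R B u : scomp R B -> u \in R -> has (fun D : {set V} => u \in D) B.
Proof. by rewrite scompE => /and3P[_ _ /eqP<-]; rewrite mem_bigcup_seq. Qed.

Lemma scomp_inj R B D D' u :
  scomp R B -> D \in B -> D' \in B -> u \in D -> u \in D' -> D = D'.
Proof.
rewrite scompE => /and3P[_ /(pairwiseP set0) dB _] DB D'B uD uD'.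
rewrite -(nth_index set0 DB) -(nth_index set0 D'B); congr nth.
have iD : (index D B < size B)%N by rewrite index_mem.
have iD' : (index D' B < size B)%N by rewrite index_mem.
have [lt|lt|//] := ltngtP (index D B) (index D' B).
  have := dB _ _ iD iD' lt; rewrite !nth_index // => d.
  by rewrite (disjointFr d uD) in uD'.
have := dB _ _ iD' iD lt; rewrite !nth_index // => d.
by rewrite (disjointFr d uD') in uD.
Qed.

Section Rank.
Variable B : seq {set V}.
Hypothesis compB : scomp [set: V] B.

Definition rank (u : V) := find (fun D : {set V} => u \in D) B.
Local Notation frank W := (find (fun D : {set V} => ~~ [disjoint D & W]) B).

Lemma mem_nth_rank u : u \in nth set0 B (rank u).
Proof. by apply: (@nth_find _ set0 (fun D : {set V} => u \in D)); apply: scomp_has compB _. Qed.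

Lemma frank_le W u : u \in W -> (frank W <= rank u)%N.
Proof.
move=> uW; rewrite leqNgt; apply/negP=> /(before_find set0)/negbFE d.
by have := mem_nth_rank u; rewrite (disjointFl d uW).
Qed.

Lemma rank_first W u : u \in W -> u \in first B W -> rank u = frank W.
Proof.
move=> uW uF; apply/eqP; rewrite eqn_leq frank_le // andbT leqNgt.
by apply/negP=> /(before_find set0); rewrite [in X in X -> _]/= -/(first B W) uF.
Qed.

Lemma rank_nfirst W u : u \in W -> u \notin first B W -> (frank W < rank u)%N.
Proof.
move=> uW uF; rewrite ltn_neqAle frank_le // andbT.
by apply: contraNneq uF => rE; rewrite /first rE mem_nth_rank.
Qed.

Lemma first_mem W : W != set0 -> first B W \in B /\ first B W :&: W != set0.
Proof.
case/set0Pn=> u uW; have hasW : has (fun D => ~~ [disjoint D & W]) B.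
  have /hasP[D DB uD] := scomp_has compB (in_setT u).
  by apply/hasP; exists D => //; apply/pred0Pn; exists u; rewrite /= uD.
split; first by apply: mem_nth; rewrite -has_find.
by rewrite setI_eq0; apply: (@nth_find _ set0 (fun D => ~~ [disjoint D & W])).
Qed.

End Rank.

Lemma orient_edge B W :
  (first B W :&: W, W :\: first B W).1 :|: (first B W :&: W, W :\: first B W).2 = W.
Proof. by rewrite /= setIC setID. Qed.

Lemma orient_orientation E B : set0 \notin E -> scomp [set: V] B -> avoids E B ->
  orientation E (orient E B).
Proof.
move=> E0 compB avB; apply/andP; split; apply/forall_inP.
  move=> _ /imsetP[W WE ->]; have W0 : W != set0 by apply: contraNneq E0 => <-.
  have [FB FW] := first_mem compB W0.
  rewrite orient_edge WE andbT /= FW setD_eq0.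
  have /forall_inP/(_ W WE)-> := allP avB _ FB.
  by rewrite disjoint_sym disjoints_subset setCI; apply/subsetP=> u; rewrite !inE => /andP[->].
move=> W WE; rewrite (_ : [set _ in _ | _] = [set (first B W :&: W, W :\: first B W)]).
  by rewrite cards1.
apply/setP=> o; rewrite inE in_set1; apply/andP/eqP => [[/imsetP[W' _ ->]]|->].
  by rewrite orient_edge => /eqP->.
by rewrite orient_edge eqxx; split=> //; apply: imset_f.
Qed.

(** The index in [B] of the block containing an element is constant on each head, hence on each
    class of V/O, and strictly increases along arcs. *)
Lemma orient_acyclic E B : scomp [set: V] B -> acyclic (orient E B).
Proof.
move=> compB; set O := orient E B.
have rank_head o a a' : o \in O -> a \in o.1 -> a' \in o.1 -> rank B a = rank B a'.
  case/imsetP=> W _ -> /=; rewrite !inE => /andP[aF aW] /andP[a'F a'W].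
  by rewrite (rank_first compB aW aF) (rank_first compB a'W a'F).
have rank_bl u v : v \in block_of O u -> rank B v = rank B u.
  rewrite inE => /connectP[p]; elim: p u => [|w p IHp] u /=; first by move=> _ ->.
  case/andP=> /exists_inP[o oO /andP[uo wo]] pw /IHp->//.
  exact: rank_head wo uo.
(* By [rank_bl] the rank is constant on a class; the maximum merely reads off this common value. *)
pose h (C : {set V}) := \max_(u in C) rank B u.
have hE u : h (block_of O u) = rank B u.
  apply/eqP; rewrite eqn_leq; apply/andP; split; last exact/leq_bigmax_cond/mem_bl.
  by apply/bigmax_leqP=> v /rank_bl->.
have arc_lt C D : arc O C D -> (h C < h D)%N.
  case/arcE=> o [a [b [/imsetP[W _ ->] /= + + -> ->]]]; rewrite !hE !inE.
  case/andP=> aF aW /andP[bF bW].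
  by rewrite (rank_first compB aW aF) rank_nfirst.
apply/forallP=> C; apply/forallP=> D; apply/implyP=> /arc_lt CD.
apply/negP=> /connectP[p]; rewrite ltnNge in CD; move: CD => + pD CE.
rewrite CE; case/negP; elim: p D pD {CE} => //= D' p IHp D /andP[/arc_lt/ltnW DD' /IHp].
exact: leq_trans.
Qed.

(** Compatibility with an orientation already forces avoidance: a block containing a hyperedge would
    be the first block meeting it, and would then contain its tail, which is nonempty and disjoint
    from the head. *)
Lemma compat_orient E O B : orientation E O -> scomp [set: V] B ->
  avoids E B && (orient E B == O) = compat O [set: V] B.
Proof.
move=> orO compB; have /andP[/forall_inP or1 /forall_inP or2] := orO.
apply/andP/forall_inP => [[_ /eqP<-] _ /imsetP[W _ ->]|cB].
  by rewrite orient_edge eqxx implybT.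
have {}cB o : o \in O -> first B (o.1 :|: o.2) :&: (o.1 :|: o.2) = o.1.
  by move=> oO; have := cB o oO; rewrite subsetT => /eqP.
have edgeE W : W \in E -> exists2 o, o \in O & o.1 :|: o.2 = W.
  by move/or2/cards1P=> [o /setP/(_ o)]; rewrite inE in_set1 eqxx => /andP[oO /eqP]; exists o.
have oE o : o \in O ->
    (first B (o.1 :|: o.2) :&: (o.1 :|: o.2), (o.1 :|: o.2) :\: first B (o.1 :|: o.2)) = o.
  move=> oO; rewrite cB // [RHS]surjective_pairing; congr pair.
  apply/setP=> u; have /setP/(_ u) := cB o oO; rewrite !inE.
  have := @orient_disj _ _ orO o u oO.
  case: (u \in o.1); case: (u \in o.2); case: (u \in first _ _) => //=.
  by move/(_ isT isT).
split.
  apply/allP=> D DB; apply/forall_inP=> W /edgeE[o oO oW]; apply/negP=> /subsetP sWD.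
  have [a [b [ao bo]]] := orient_neq0 orO oO.
  have W0 : W != set0 by apply/set0Pn; exists a; rewrite -oW inE ao.
  have [FB _] := first_mem compB W0; have FE := cB o oO; rewrite oW in FE.
  have aW : a \in W by rewrite -oW inE ao.
  have bW : b \in W by rewrite -oW inE bo orbT.
  have aF : a \in first B W by move: ao; rewrite -FE inE => /andP[].
  have DF := scomp_inj compB DB FB (sWD a aW) aF.
  apply: (orient_disj orO oO _ bo).
  by rewrite -FE inE bW andbT -DF sWD.
apply/eqP/setP=> o; apply/imsetP/idP => [[W /edgeE[o' o'O <-] ->]|oO]; first by rewrite oE.
exists (o.1 :|: o.2); last by rewrite oE.
by have /and4P[] := or1 o oO.
Qed.

Theorem sum_acyclic_orientations E : set0 \notin E ->
  \sum_(B <- scomps [set: V] | avoids E B) (-1) ^+ size B =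
  \sum_(O in acyclic_orientations E) (-1) ^+ size (comp_of O) :> int.
Proof.
move=> E0; rewrite big_seq_cond.
rewrite (partition_big (orient E) (mem (acyclic_orientations E))) /=; last first.
  move=> B; rewrite mem_scomps => /andP[compB avB].
  by rewrite inE orient_orientation // orient_acyclic.
apply: eq_bigr => O; rewrite inE => /andP[orO acO].
rewrite size_comp_of // -(sum_compat orO acO) [RHS]big_seq_cond.
apply: eq_bigl => B; rewrite mem_scomps -andbA; apply: andb_id2l => compB.
exact: compat_orient.
Qed.

End AcyclicOrientations.

Local Open Scope fset_scope.
Local Open Scope ring_scope.

(** * Reorderings and sequences of disjoint finite sets *)

(** Reduces invariance under all permutations to exchanging the first two entries. *)
Lemma perm_swap_ind (T : eqType) (P : seq T -> seq T -> Prop) :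
  (forall s, P s s) -> (forall a s t, P s t -> P (a :: s) (a :: t)) ->
  (forall a b s, P [:: a, b & s] [:: b, a & s]) ->
  (forall s t r, P s t -> P t r -> P s r) ->
  forall s t, perm_eq s t -> P s t.
Proof.
move=> Prefl Pcons Pswap Ptrans.
have Pmove a t1 t2 : P (a :: t1 ++ t2) (t1 ++ a :: t2).
  elim: t1 => [|b t1 IHt]; first exact: Prefl.
  exact: Ptrans (Pswap _ _ _) (Pcons _ _ _ IHt).
elim=> [|a s IHs] t; first by rewrite perm_sym => /perm_nilP->.
move=> st; have at_ : a \in t by rewrite -(perm_mem st) mem_head.
move: st; case: (splitPr at_) => t1 t2 st; apply: Ptrans (Pmove a t1 t2).
apply/Pcons/IHs; rewrite -(perm_cons a); apply: perm_trans st _.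
by rewrite -[a :: t1 ++ t2]cat1s -[a :: t2]cat1s perm_catCA.
Qed.

Section FsetPointwise.
Variable U : choiceType.
Implicit Types (A B J : {fset U}) (s t : seq {fset U}).

Lemma decompP J A B :
  reflect (forall u, ((u \in J) == (u \in A) || (u \in B)) &&
                     ~~ ((u \in A) && (u \in B))) (decomp J A B).
Proof.
apply: (iffP andP) => [[/eqP<- /fdisjointP dAB] u | AB].
  by rewrite inE eqxx /=; apply/negP=> /andP[/dAB/negP].
split; first by apply/eqP/fsetP=> u; have /andP[/eqP->] := AB u; rewrite inE.
by apply/fdisjointP=> u uA; have /andP[_] := AB u; rewrite uA.
Qed.

Lemma fsubset_pointwiseP A B :
  reflect (forall u, (u \in A) ==> (u \in B)) (A `<=` B).
Proof.
by apply: (iffP (@fsubsetP _ A B)) => sAB u; [apply/implyP/sAB | apply/implyP/sAB].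
Qed.

Lemma fdisjoint_pointwiseP A B :
  reflect (forall u, ~~ ((u \in A) && (u \in B))) [disjoint A & B]%fset.
Proof.
apply: (iffP (@fdisjointP _ A B)) => dAB u; last by move=> uA; have := dAB u; rewrite uA.
by apply/negP=> /andP[/dAB/negP].
Qed.

Lemma cup_cons A s : cup (A :: s) = A `|` cup s.
Proof. by rewrite /cup big_cons. Qed.

Lemma cup_nil : cup (Nil {fset U}) = fset0.
Proof. by rewrite /cup big_nil. Qed.

Lemma cup_cat s t : cup (s ++ t) = cup s `|` cup t.
Proof. by rewrite /cup big_cat. Qed.

Lemma cup_flatten (ss : seq (seq {fset U})) :
  cup (flatten ss) = cup [seq cup s | s <- ss].
Proof. by elim: ss => //= s ss IHs; rewrite cup_cat cup_cons IHs. Qed.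

Lemma cup_perm s t : perm_eq s t -> cup s = cup t :> {fset U}.
Proof. exact: perm_big. Qed.

Lemma cupP u (s : seq {fset U}) : reflect (exists2 A, A \in s & u \in A) (u \in cup s).
Proof.
apply: (iffP (bigfcupP _ _ _ _)) => [[A]|[A As uA]]; last by exists A; rewrite ?As.
by rewrite andbT; exists A.
Qed.

Lemma mem_sub_cup A s : A \in s -> A `<=` cup s.
Proof. by move=> As; apply/fsubsetP=> u uA; apply/cupP; exists A. Qed.

Definition pdisj (s : seq {fset U}) : bool :=
  pairwise (fun A B : {fset U} => [disjoint A & B]%fset) s.

Lemma disjoint_cup A s :
  [disjoint A & cup s]%fset = all (fun B => [disjoint A & B]%fset) s.
Proof.
apply/fdisjointP/allP => [dA B Bs | dA u uA].
  by apply/fdisjointP=> u /dA; apply: contra; apply/fsubsetP/mem_sub_cup.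
by apply/cupP=> -[B /dA/fdisjointP/(_ _ uA)/negP].
Qed.

Lemma pdisj_cons A s : pdisj (A :: s) = [disjoint A & cup s]%fset && pdisj s.
Proof. by rewrite disjoint_cup. Qed.

Lemma pdisj_perm s t : perm_eq s t -> pdisj s = pdisj t.
Proof.
move=> st; suff [] : cup s = cup t /\ pdisj s = pdisj t by [].
move: s t st; apply: (perm_swap_ind
  (P := fun s t => cup s = cup t /\ pdisj s = pdisj t))
  => // [A s t [cst dst] | A B s | s t r [-> ->] //].
  by rewrite !cup_cons !pdisj_cons cst dst.
rewrite !cup_cons fsetUCA !pdisj_cons !cup_cons !fdisjointXU (fdisjoint_sym A B).
by split=> //; rewrite -!andbA; congr andb; rewrite andbCA.
Qed.

Lemma pdisj_cat s t : pdisj (s ++ t) =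
  [&& [disjoint cup s & cup t]%fset, pdisj s & pdisj t].
Proof.
elim: s => [|A s IHs]; first by rewrite cup_nil fdisjoint0X.
rewrite cat_cons !pdisj_cons cup_cat cup_cons IHs fdisjointXU fdisjointUX.
by do !case: (fdisjoint _ _) => //=; rewrite ?andbF.
Qed.

Lemma pdisj_decomp A s : pdisj (A :: s) -> decomp (cup (A :: s)) A (cup s).
Proof. by rewrite pdisj_cons => /andP[dA _]; rewrite /decomp cup_cons eqxx. Qed.

End FsetPointwise.

(* Proves inclusions, disjointness, equality and decomp of Boolean            *)
(* combinations of finite sets from hypotheses of the same kind, by checking  *)
(* them at a point.                                                           *)
Ltac fset_solve :=
  let u := fresh "u" in
  match goal with
  | |- is_true (decomp _ _ _) => apply/decompP=> u
  | |- is_true (fsubset _ _) => apply/fsubset_pointwiseP=> u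
  | |- is_true (fdisjoint _ _) => apply/fdisjoint_pointwiseP=> u
  | |- @eq _ _ _ => apply/fsetP=> u
  end;
  repeat match goal with
  | h : is_true (decomp _ _ _) |- _ => move/decompP/(_ u): h
  | h : is_true (fsubset _ _) |- _ => move/fsubset_pointwiseP/(_ u): h
  | h : is_true (fdisjoint _ _) |- _ => move/fdisjoint_pointwiseP/(_ u): h
  end;
  rewrite ?inE /=; do ?[case: (u \in _) => //=].

(** * Basis elements and pure tensors *)

Section Basis.
Variable K : fieldType.

(** The tensor operations are defined by their values on basis elements; this predicate allows
    computing with them on pure tensors of basis elements without naming those elements. *)
Definition isb (T : choiceType) (v : {malg K[T]}) : Prop := exists t, v = << t >>.

Lemma malgU_inj (T : choiceType) (c : K) (s t : T) :
  c *: << s >> = << t >> -> c = 1 /\ s = t.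
Proof.
move/malgP/(_ t); rewrite mcoeffZ !mcoeffU eqxx.
have [-> | _] := eqVneq s t; first by rewrite mulr1.
by rewrite mulr0 => /esym/eqP; rewrite oner_eq0.
Qed.

Lemma malgU1_inj (T : choiceType) (s t : T) : << s >> = << t >> :> {malg K[T]} -> s = t.
Proof. by rewrite -[<< s >>]scale1r => /malgU_inj[]. Qed.

Lemma isb_neq0 (T : choiceType) (v : {malg K[T]}) : isb v -> v != 0.
Proof.
case=> t ->; apply/eqP=> /malgP/(_ t)/eqP.
by rewrite mcoeffU eqxx mcoeff0 oner_eq0.
Qed.

Lemma linext0 (T : choiceType) (V : lmodType K) (f : T -> V) : linext f 0 = 0.
Proof. by rewrite /linext msupp0 big_seq_fset0. Qed.

Section Tens.
Variables S T : choiceType.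
Implicit Types (v : {malg K[S]}) (w : {malg K[T]}).

Lemma isb_tens v w : isb v -> isb w -> isb (tens v w).
Proof. by move=> [s ->] [t ->]; exists (s, t); rewrite tensU. Qed.

Lemma tens0 v : tens v (0 : {malg K[T]}) = 0.
Proof. by rewrite /tens big1 // => s _; rewrite msupp0 big_seq_fset0. Qed.

Lemma tens_inj v v' w w' : isb v -> isb w -> isb v' -> isb w' ->
  tens v w = tens v' w' -> v = v' /\ w = w'.
Proof.
move=> [s ->] [t ->] [s' ->] [t' ->].
by rewrite !tensU => /malgU1_inj[-> ->].
Qed.

Lemma tmap_tens (S' T' : choiceType) (f : {malg K[S]} -> {malg K[S']})
    (g : {malg K[T]} -> {malg K[T']}) v w :
  isb v -> isb w -> tmap f g (tens v w) = tens (f v) (g w).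
Proof. by move=> [s ->] [t ->]; rewrite tensU /tmap linextU. Qed.

Lemma tmap0 (S' T' : choiceType) (f : {malg K[S]} -> {malg K[S']})
    (g : {malg K[T]} -> {malg K[T']}) : tmap f g 0 = 0.
Proof. exact: linext0. Qed.

Lemma tswap_tens v w : isb v -> isb w -> tswap (tens v w) = tens w v.
Proof. by move=> [s ->] [t ->]; rewrite !tensU /tswap linextU. Qed.

End Tens.

Lemma tens0l (S T : choiceType) (w : {malg K[T]}) : tens (0 : {malg K[S]}) w = 0.
Proof. by rewrite /tens msupp0 big_seq_fset0. Qed.

Lemma tassoc_tens (R S T : choiceType) (u : {malg K[R]}) (v : {malg K[S]})
  (w : {malg K[T]}) : isb u -> isb v -> isb w ->
  tassoc (tens (tens u v) w) = tens u (tens v w).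
Proof. by move=> [r ->] [s ->] [t ->]; rewrite !tensU /tassoc linextU. Qed.

Lemma tassoc0 (R S T : choiceType) :
  tassoc (0 : {malg K[((R * S) * T)%type]}) = 0.
Proof. exact: linext0. Qed.

Lemma tswap_mid_tens (R S R' S' : choiceType) (u : {malg K[R]}) (v : {malg K[S]})
  (u' : {malg K[R']}) (v' : {malg K[S']}) : isb u -> isb v -> isb u' -> isb v' ->
  tswap_mid (tens (tens u v) (tens u' v')) = tens (tens u u') (tens v v').
Proof.
by move=> [r ->] [s ->] [r' ->] [s' ->]; rewrite !tensU /tswap_mid linextU.
Qed.

End Basis.

(** * Products and coproducts of basis elements *)

Section LinearizedHopf.
Variables (K : fieldType) (U : choiceType) (H : hopf_monoid K U).
Hypotheses (Hcomm : commutative_hopf H) (Hcocomm : cocommutative_hopf H).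
Hypothesis Hlin : linearized H.
Implicit Types (A B C I J P Q S T : {fset U}) (s t : seq {fset U}).

Lemma isb_mu J A B (v : {malg K[basis H A]}) (w : {malg K[basis H B]}) :
  decomp J A B -> isb v -> isb w -> isb (mu H J A B (tens v w)).
Proof. by move=> JAB [a ->] [b ->]; have [c ->] := Hlin.1 _ _ _ a b JAB; exists c. Qed.

Lemma Delta_isb J A B (v : {malg K[basis H J]}) : decomp J A B -> isb v ->
  Delta H J A B v = 0 \/ exists a b, [/\ isb a, isb b & Delta H J A B v = tens a b].
Proof.
move=> JAB [c ->]; have [->|[a [b ->]]] := Hlin.2 _ _ _ c JAB; first by left.
by right; exists << a >>, << b >>; split=> //; [exists a | exists b].
Qed.

(** Write the coproduct of a basis element e of H[[fset0]] as a tensor a, b of basis elements. The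
    counit axioms make both b and a scalar multiples of e, hence equal to e with counit 1;
    connectedness then gives e = 1. *)
Lemma hcounit_isb (v : {malg K[basis H fset0]}) :
  isb v -> hcounit H fset0 v = 1 /\ v = hunit H fset0.
Proof.
case=> e ->; have d0 : decomp (fset0 : {fset U}) fset0 fset0 by fset_solve.
have [||[_ [_ [[a ->] [b ->] dE]]]] := @Delta_isb fset0 fset0 fset0 << e >> d0.
- by exists e.
- move=> De; have := Delta_counitl << e >>; rewrite De linext0 => /esym/eqP.
  by rewrite (negPf (isb_neq0 _)) //; exists e.
have := Delta_counitl << e >>; rewrite dE tensU linextU /= => /malgU_inj[ea be].
have := Delta_counitr << e >>; rewrite dE tensU linextU /= => /malgU_inj[eb ae].
rewrite -{1}be eb; split=> //.
by rewrite -[LHS]hcounitK -be eb scale1r.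
Qed.

Lemma isb_hunit : isb (hunit H fset0).
Proof.
have [sup0|/fset0Pn[e _]] := eqVneq (msupp (hunit H fset0)) fset0.
  have h0 : hunit H fset0 = 0.
    by apply/malgP=> k; rewrite mcoeff0 mcoeff_outdom // sup0.
  by have := hunitK H; rewrite h0 raddf0 => /esym/eqP; rewrite oner_eq0.
exists e; have be : isb (<< e >> : {malg K[basis H fset0]}) by exists e.
by rewrite -(hcounit_isb be).2.
Qed.

Lemma Delta_set0l J (v : {malg K[basis H J]}) : isb v ->
  Delta H J fset0 J v = tens (hunit H fset0) v.
Proof.
move=> bv; have dJ : decomp J fset0 J by fset_solve.
have := Delta_counitl v.
have [->|[a [b [/[dup] ba [a' aE] [b' bE] ->]]]] := Delta_isb dJ bv.
  by rewrite linext0 => /esym/eqP; rewrite (negPf (isb_neq0 bv)).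
have [ea ah] := hcounit_isb ba.
by rewrite {1}aE {1}bE tensU linextU /= -aE -bE ea scale1r ah => ->.
Qed.

Lemma Delta_set0r J (v : {malg K[basis H J]}) : isb v ->
  Delta H J J fset0 v = tens v (hunit H fset0).
Proof.
move=> bv; have dJ : decomp J fset0 J by fset_solve.
by rewrite (Hcocomm _ dJ) Delta_set0l // tswap_tens //; apply: isb_hunit.
Qed.

(** The compatibility axiom on pure tensors, with the four intersections passed as variables so that
    they may be written in any convenient form. *)
Lemma Delta_mu_tens J S T P Q SP SQ TP TQ (v : {malg K[basis H S]})
  (w : {malg K[basis H T]}) v1 v2 w1 w2 :
  decomp J S T -> decomp J P Q ->
  decomp S SP SQ -> decomp T TP TQ -> decomp P SP TP -> decomp Q SQ TQ ->
  isb v1 -> isb v2 -> isb w1 -> isb w2 ->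
  Delta H S SP SQ v = tens v1 v2 -> Delta H T TP TQ w = tens w1 w2 ->
  Delta H J P Q (mu H J S T (tens v w)) =
  tens (mu H P SP TP (tens v1 w1)) (mu H Q SQ TQ (tens v2 w2)).
Proof.
move=> JST JPQ dS dT dP dQ.
have [eSP eSQ] : SP = S `&` P /\ SQ = S `&` Q by split; fset_solve.
have [eTP eTQ] : TP = T `&` P /\ TQ = T `&` Q by split; fset_solve.
subst SP SQ TP TQ => bv1 bv2 bw1 bw2 vE wE.
rewrite mu_Delta_compat // vE wE tswap_mid_tens // tmap_tens //; exact: isb_tens.
Qed.

(** Compatibility for the same decomposition twice: the mixed intersections are empty, so they
    contribute only units. *)
Lemma Delta_muK J P Q (v : {malg K[basis H P]}) (w : {malg K[basis H Q]}) :
  decomp J P Q -> isb v -> isb w -> Delta H J P Q (mu H J P Q (tens v w)) = tens v w.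
Proof.
move=> JPQ bv bw; have b1 := isb_hunit.
have dP : decomp P P fset0 by fset_solve.
have dQ : decomp Q fset0 Q by fset_solve.
rewrite (Delta_mu_tens JPQ JPQ dP dQ dP dQ bv b1 b1 bw) ?mu_unitl ?mu_unitr //.
  exact: Delta_set0r.
exact: Delta_set0l.
Qed.

Lemma mu_tens_inj J P Q (v v' : {malg K[basis H P]}) (w w' : {malg K[basis H Q]}) :
  decomp J P Q -> isb v -> isb w -> isb v' -> isb w' ->
  mu H J P Q (tens v w) = mu H J P Q (tens v' w') -> v = v' /\ w = w'.
Proof.
move=> JPQ bv bw bv' bw' /(congr1 (Delta H J P Q)).
by rewrite !Delta_muK //; apply: tens_inj.
Qed.

Section Products.
Variable f : forall A, {malg K[basis H A]}.

(** What [mu_seq] gives on the pure tensor of the [f A], with the tensor product removed. *)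
Fixpoint mprod s J : {malg K[basis H J]} :=
  if s is A :: s' then mu H J A (cup s') (tens (f A) (mprod s' (cup s')))
  else hunit H J.

Lemma mu_seq_tens_seq s J : (forall A, A \in s -> isb (f A)) ->
  mu_seq J (tens_seq f s) = mprod s J.
Proof.
move=> bf; suff [] : isb (tens_seq f s) /\ mu_seq J (tens_seq f s) = mprod s J by [].
elim: s J bf => [|A s IHs] J bf /=.
  by rewrite mcoeffUU scale1r; split=> //; exists tt.
have [|bs sE] := IHs (cup s); first by move=> B Bs; apply: bf; rewrite inE Bs orbT.
have bA : isb (f A) by apply: bf; rewrite mem_head.
split; first exact: isb_tens.
by rewrite tmap_tens // sE.
Qed.

Lemma isb_mprod s : pdisj s -> (forall A, A \in s -> isb (f A)) ->
  isb (mprod s (cup s)).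
Proof.
elim: s => [|A s IHs] ds bf; first by rewrite cup_nil; apply: isb_hunit.
apply: isb_mu; first exact: pdisj_decomp.
  by apply: bf; rewrite mem_head.
apply: IHs => [|B Bs]; first by move: ds; rewrite pdisj_cons => /andP[].
by apply: bf; rewrite inE Bs orbT.
Qed.

Lemma mprod_perm s t : perm_eq s t -> pdisj s ->
  mprod s (cup s) = mprod t (cup s).
Proof.
move=> st ds.
suff [] : [/\ cup s = cup t, pdisj t & mprod s (cup s) = mprod t (cup s)] by [].
move: s t st ds; apply: (perm_swap_ind (P := fun s t => pdisj s ->
  [/\ cup s = cup t, pdisj t & mprod s (cup s) = mprod t (cup s)]))
  => // [A s t IHs|A B s|s t r IHs IHt].
- rewrite pdisj_cons => /andP[dA ds]; have [cst dt fst_] := IHs ds.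
  rewrite pdisj_cons !cup_cons -cst dt; split=> //; first by rewrite dA.
  by rewrite /= -cst fst_.
- move=> dABs; have pAB : perm_eq [:: A, B & s] [:: B, A & s].
    by rewrite -(cat1s A) -(cat1s B) perm_catCA.
  rewrite -(pdisj_perm pAB) -(cup_perm pAB); split=> //.
  move: dABs; rewrite !pdisj_cons !cup_cons => /and3P[dA dB _] /=.
  have dAs : decomp (A `|` cup s) A (cup s) by fset_solve.
  have dBs : decomp (B `|` cup s) B (cup s) by fset_solve.
  have dAB : decomp (A `|` B) A B by fset_solve.
  have dBA : decomp (A `|` B) B A by fset_solve.
  have dJ : decomp (A `|` (B `|` cup s)) (A `|` B) (cup s) by fset_solve.
  rewrite !cup_cons -(mu_assoc _ _ _ dAB dJ dBs) -?(mu_assoc _ _ _ dBA dJ dAs);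
    try by fset_solve.
  by rewrite (Hcomm _ _ dAB).
- case/IHs=> cst dt fst_; case: (IHt dt) => ctr dr ftr; split=> //; first by rewrite cst.
  by rewrite fst_ cst.
Qed.

Lemma mprod_cat s t : pdisj (s ++ t) -> mprod (s ++ t) (cup (s ++ t)) =
  mu H (cup (s ++ t)) (cup s) (cup t) (tens (mprod s (cup s)) (mprod t (cup t))).
Proof.
elim: s => [|A s IHs]; first by rewrite cup_nil mu_unitl.
rewrite cat_cons pdisj_cons => /andP[dA dst] /=.
rewrite IHs //; move: dst; rewrite pdisj_cat => /and3P[dst _ _].
move: dA; rewrite !cup_cons !cup_cat => dA.
by rewrite (@mu_assoc _ _ H _ _ _ _ _ (cup s `|` cup t)) //; fset_solve.
Qed.

End Products.

Lemma Delta_seq_cons A s J (v : {malg K[basis H J]}) :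
  Delta_seq (A :: s) v =
  tmap id (@Delta_seq _ _ H s (cup s)) (Delta H J A (cup s) v).
Proof. by []. Qed.

(** * Restrictions of x and nonvanishing of its iterated coproducts *)

Section Restriction.
Variables (I : {fset U}) (x : basis H I).
Local Notation X := (<< x >> : {malg K[basis H I]}).
Local Notation R := (restr x).

(** Exactly then is x_P a basis element; otherwise [restr x P] is 0. *)
Definition cutable P := Delta H I P (I `\` P) X != 0.

(** [restr] reads off a left factor; cocommutativity identifies the right factor with the
    restriction to the complement. *)
Lemma Delta_restr P Q : decomp I P Q -> Delta H I P Q X != 0 ->
  [/\ isb (R P), isb (R Q) & Delta H I P Q X = tens (R P) (R Q)].
Proof.
move=> dI nz; have QE : Q = I `\` P by fset_solve.
have PE : I `\` Q = P by fset_solve.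
have bX : isb X by exists x.
have [D0|[_ [_ [[a ->] [b ->] DE]]]] := Delta_isb dI bX; first by rewrite D0 eqxx in nz.
have RP : R P = << a >> by rewrite /restr -QE DE tensU linextU.
have RQ : R Q = << b >>.
  rewrite /restr PE (Hcocomm _ dI) DE tswap_tens ?tensU ?linextU //; first by exists a.
  by exists b.
by rewrite RP RQ; split=> //; [exists a | exists b].
Qed.

Lemma isb_restr P : P `<=` I -> cutable P -> isb (R P).
Proof. by move=> sPI cP; have [] := Delta_restr _ cP; first by fset_solve. Qed.

Lemma Delta_restrC J P Q : decomp J P Q ->
  (Delta H J Q P (R J) != 0) = (Delta H J P Q (R J) != 0).
Proof.
move=> dJ; suff nzC P' Q' : decomp J P' Q' ->
    Delta H J Q' P' (R J) != 0 -> Delta H J P' Q' (R J) != 0.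
  by apply/idP/idP; apply: nzC; rewrite // ; fset_solve.
move=> dJ'; rewrite (Hcocomm _ dJ'); apply: contraNN => /eqP->.
by rewrite /tswap linext0.
Qed.

(** By coassociativity, cutting x along [J] and then x_J along [P] has the same leftmost factor as
    cutting x along [P] directly. *)
Lemma restr_Delta_l J P Q : J `<=` I -> decomp J P Q -> cutable J ->
  Delta H J P Q (R J) != 0 ->
  cutable P /\ exists2 b, isb b & Delta H J P Q (R J) = tens (R P) b.
Proof.
move=> sJI dJ cJ nzJ.
have dIJ : decomp I J (I `\` J) by fset_solve.
have dIP : decomp I P (I `\` P) by fset_solve.
have dQC : decomp (I `\` P) Q (I `\` J) by fset_solve.
have [bJ bC DJ] := Delta_restr dIJ cJ.
have [D0|[a [b [ba bb DE]]]] := Delta_isb dJ bJ; first by rewrite D0 eqxx in nzJ.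
have := Delta_coassoc X dJ dIJ dQC dIP.
rewrite DJ tmap_tens // DE tassoc_tens // => abE.
have babC : isb (tens a (tens b (R (I `\` J)))) by do 2?apply: isb_tens.
have cP : cutable P.
  apply/eqP=> DP0; move: (isb_neq0 babC); rewrite abE.
  by rewrite DP0 tmap0 eqxx.
split=> //; have [bP bP' DP] := Delta_restr dIP cP.
move: abE; rewrite DP tmap_tens //.
have [D0|[b' [c [bb' bc ->]]]] := Delta_isb dQC bP'.
  by move=> abE; move: (isb_neq0 babC); rewrite abE D0 tens0 eqxx.
by case/tens_inj=> // [||-> _]; try exact: isb_tens; exists b.
Qed.

Lemma restr_Delta J P Q : J `<=` I -> decomp J P Q -> cutable J ->
  Delta H J P Q (R J) != 0 ->
  [/\ cutable P, cutable Q & Delta H J P Q (R J) = tens (R P) (R Q)].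
Proof.
move=> sJI dJ cJ nzJ; have dJ' : decomp J Q P by fset_solve.
have [cP [b bb DE]] := restr_Delta_l sJI dJ cJ nzJ.
have := nzJ; rewrite Delta_restrC // => nzJ'.
have [cQ [a ba]] := restr_Delta_l sJI dJ' cJ nzJ'.
have [bP bQ] : isb (R P) /\ isb (R Q) by split; apply: isb_restr => //; fset_solve.
rewrite (Hcocomm _ dJ) DE tswap_tens // => /tens_inj[] // bE _.
by rewrite bE.
Qed.

Lemma Delta_I0 : Delta H I I fset0 X = tens X (hunit H fset0).
Proof. by rewrite Delta_set0r //; exists x. Qed.

Lemma cutable_I : cutable I.
Proof.
rewrite /cutable fsetDv Delta_I0; apply/isb_neq0/isb_tens; last exact: isb_hunit.
by exists x.
Qed.

Lemma restr_I : R I = X.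
Proof.
have [e eE] := isb_hunit.
by rewrite /restr fsetDv Delta_I0 eE tensU linextU.
Qed.

(** Both sides say that the double coproduct of x_J along A, B, C is nonzero. *)
Lemma restr_coassoc J A B C AB BC : J `<=` I -> cutable J ->
  decomp AB A B -> decomp J AB C -> decomp BC B C -> decomp J A BC ->
  (Delta H J A BC (R J) != 0) && (Delta H BC B C (R BC) != 0) =
  (Delta H J AB C (R J) != 0) && (Delta H AB A B (R AB) != 0).
Proof.
move=> sJI cJ dAB dJC dBC dJA; have := Delta_coassoc (R J) dAB dJC dBC dJA.
have bJ := isb_restr sJI cJ.
have -> : (Delta H J A BC (R J) != 0) && (Delta H BC B C (R BC) != 0) =
    (tmap id (Delta H BC B C) (Delta H J A BC (R J)) != 0).
  have [->|nz] := eqVneq (Delta H J A BC (R J)) 0; first by rewrite tmap0 !eqxx.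
  have [cA cBC ->] := restr_Delta sJI dJA cJ nz.
  have bA : isb (R A) by apply: isb_restr => //; fset_solve.
  have bBC : isb (R BC) by apply: isb_restr => //; fset_solve.
  rewrite tmap_tens //=.
  have [->|[b [c [bb bc ->]]]] := Delta_isb dBC bBC; first by rewrite tens0 !eqxx.
  by rewrite !isb_neq0 //; do ?apply: isb_tens => //.
move<-.
have [->|nz] := eqVneq (Delta H J AB C (R J)) 0; first by rewrite tmap0 tassoc0 !eqxx.
have [cAB cC ->] := restr_Delta sJI dJC cJ nz.
have bC : isb (R C) by apply: isb_restr => //; fset_solve.
have bAB : isb (R AB) by apply: isb_restr => //; fset_solve.
rewrite tmap_tens //=.
have [->|[a [b [ba bb ->]]]] := Delta_isb dAB bAB; first by rewrite tens0l tassoc0 !eqxx.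
by rewrite tassoc_tens // !isb_neq0 //; do ?apply: isb_tens => //.
Qed.

(** Nonvanishing of the iterated coproduct of x restricted to [cup s], unfolded into one condition
    per cut; [okseq] adds what makes these restrictions meaningful. *)
Fixpoint nonzero s : bool :=
  if s is A :: s' then (Delta H (cup s) A (cup s') (R (cup s)) != 0) && nonzero s'
  else true.

Lemma nonzero_cons A s : nonzero (A :: s) =
  (Delta H (cup (A :: s)) A (cup s) (R (cup (A :: s))) != 0) && nonzero s.
Proof. by []. Qed.

Definition okseq s := [&& pdisj s, cup s `<=` I, cutable (cup s) & nonzero s].

(** By [restr_Delta] each nonzero cut produces restrictions of x again, so the iterated coproduct is
    zero or the pure tensor of the x_A. *)
Lemma Delta_seq_restr s : pdisj s -> cup s `<=` I -> cutable (cup s) ->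
  Delta_seq s (R (cup s)) = if nonzero s then tens_seq R s else 0.
Proof.
elim: s => [|A s IHs] ds sI cs.
  rewrite /= cup_nil (hcounit_isb _).1 //.
  by rewrite -cup_nil; apply: isb_restr.
rewrite nonzero_cons Delta_seq_cons.
case: eqVneq => [->|nz]; first by rewrite tmap0.
have dA := pdisj_decomp ds.
have [cA cs' ->] := restr_Delta sI dA cs nz.
have sI' : cup s `<=` I by fset_solve.
have bA : isb (R A) by apply: isb_restr => //; fset_solve.
rewrite tmap_tens //; last exact: isb_restr.
rewrite IHs //; last by move: ds; rewrite pdisj_cons => /andP[].
by case: nonzero; rewrite ?tens0.
Qed.

Lemma okseq_behead A s : okseq (A :: s) -> okseq s /\ cutable A.
Proof.
case/and4P=> /[dup] ds /[!pdisj_cons]/andP[_ ds'] sI cs /[!nonzero_cons]/andP[nz nz'].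
have dA := pdisj_decomp ds; have [cA cs' _] := restr_Delta sI dA cs nz.
by split=> //; apply/and4P; split=> //; fset_solve.
Qed.

Lemma okseq_isb s : okseq s -> forall A, A \in s -> isb (R A).
Proof.
elim: s => // B s IHs okBs A; have [oks cB] := okseq_behead okBs.
rewrite inE => /predU1P[->|]; last exact: IHs.
apply: isb_restr => //; case/and4P: okBs => _ sI _ _.
by apply: fsubset_trans sI; apply: mem_sub_cup; rewrite mem_head.
Qed.

Lemma okseq_merge A B s : okseq [:: A, B & s] =
  [&& okseq ((A `|` B) :: s), [disjoint A & B]%fset &
      Delta H (A `|` B) A B (R (A `|` B)) != 0].
Proof.
have cE : cup [:: A, B & s] = cup ((A `|` B) :: s) by rewrite !cup_cons fsetUA.
have dE : pdisj [:: A, B & s] = pdisj ((A `|` B) :: s) && [disjoint A & B]%fset.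
  rewrite !pdisj_cons cup_cons fdisjointXU fdisjointUX.
  by do !case: (fdisjoint _ _) => //; rewrite ?andbF ?andbT.
have coassoc : [disjoint A & B]%fset -> pdisj ((A `|` B) :: s) ->
    cup ((A `|` B) :: s) `<=` I -> cutable (cup ((A `|` B) :: s)) ->
    nonzero [:: A, B & s] = nonzero ((A `|` B) :: s) &&
      (Delta H (A `|` B) A B (R (A `|` B)) != 0).
  move=> dAB; rewrite pdisj_cons => /andP[dABs _] sI cI.
  rewrite !nonzero_cons cE [RHS]andbAC andbA; congr andb.
  have cBs := cup_cons B s; have cABs := cup_cons (A `|` B) s.
  by apply: restr_coassoc => //; rewrite ?cBs ?cABs; fset_solve.
rewrite /okseq cE dE; apply/idP/idP.
  by case/and4P=> /andP[ds dAB] sI cI; rewrite coassoc // ds sI cI dAB => /andP[-> ->].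
by case/and3P=> /and4P[ds sI cI nz] dAB nzAB; rewrite ds dAB sI cI coassoc // nz.
Qed.

(** After merging [A] and [B], the remaining condition is symmetric in them by cocommutativity. *)
Lemma okseq_swap A B s : okseq [:: A, B & s] = okseq [:: B, A & s].
Proof.
rewrite !okseq_merge [B `|` A]fsetUC [ [disjoint B & A]%fset]fdisjoint_sym.
congr andb; have [dAB|//] /= := boolP [disjoint A & B]%fset.
by rewrite Delta_restrC //; fset_solve.
Qed.

Lemma okseq_cons_eq A s t : cup s = cup t -> okseq s = okseq t ->
  okseq (A :: s) -> okseq (A :: t).
Proof.
move=> cst ost /[dup] okAs /okseq_behead[oks _].
have /and4P[dt _ _ nzt] : okseq t by rewrite -ost.
case/and4P: okAs => dAs sI cs; rewrite nonzero_cons => /andP[nzA nzs].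
apply/and4P; rewrite !cup_cons -cst in sI cs *; split=> //.
  by move: dAs; rewrite !pdisj_cons -cst dt => /andP[->].
by rewrite nonzero_cons !cup_cons -cst nzt andbT -cup_cons.
Qed.

Lemma okseq_perm s t : perm_eq s t -> okseq s = okseq t.
Proof.
move=> st; suff [] : cup s = cup t /\ okseq s = okseq t by [].
move: s t st; apply: (perm_swap_ind
  (P := fun s t => cup s = cup t /\ okseq s = okseq t)) => //.
- move=> A s t [cst ost]; rewrite !cup_cons cst; split=> //.
  by apply/idP/idP; apply: okseq_cons_eq.
- by move=> A B s; rewrite okseq_swap !cup_cons fsetUCA.
- by move=> s t r [-> ->].
Qed.

Lemma okseq_set0 s : okseq s -> okseq (fset0 :: s).
Proof.
case/and4P=> ds sI cs nz; apply/and4P; rewrite !cup_cons fset0U; split=> //.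
  by rewrite pdisj_cons fdisjoint0X.
rewrite nonzero_cons cup_cons fset0U nz andbT Delta_set0l; last exact: isb_restr.
by apply/isb_neq0/isb_tens; [apply: isb_hunit | apply: isb_restr].
Qed.

(** Nonvanishing survives coarsening: the parts of the initial stretch are merged one by one. *)
Lemma okseq_cat s t : okseq (s ++ t) -> okseq (cup s :: t).
Proof.
elim: s => [|A s IHs]; first by rewrite cup_nil; apply: okseq_set0.
rewrite cat_cons => /[dup] okAst /okseq_behead[okst _].
have : okseq [:: A, cup s & t].
  have okst' := IHs okst; apply: okseq_cons_eq okAst; last by rewrite okst okst'.
  by rewrite cup_cat cup_cons.
by rewrite okseq_merge cup_cons => /and3P[].
Qed.

Lemma okseq_flatten ss : okseq (flatten ss) -> okseq [seq cup s | s <- ss].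
Proof.
elim: ss => //= s ss IHss /okseq_cat/[dup] oks /okseq_behead[okf _].
by apply: okseq_cons_eq oks; [apply: cup_flatten | rewrite okf IHss].
Qed.

Lemma okseq_setcomp s : setcomp I s -> okseq s = (Delta_seq s X != 0).
Proof.
case/and3P=> _ ds /eqP cs; have cI := cutable_I.
rewrite /okseq -[pdisj s]/(pairwise _ s) ds cs fsubset_refl cI /=.
have := @Delta_seq_restr s ds; rewrite cs restr_I => /(_ (fsubset_refl _) cI) sE.
rewrite sE; case nz: nonzero; last by rewrite eqxx.
have : okseq s by rewrite /okseq -[pdisj s]/(pairwise _ s) ds cs fsubset_refl cI.
move/okseq_isb=> bs; apply/esym/isb_neq0.
elim: s bs {ds cs cI sE nz} => [|A s IHs] bs; first by exists tt.
apply: isb_tens; first by apply: bs; rewrite mem_head.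
by apply: IHs => B Bs; apply: bs; rewrite inE Bs orbT.
Qed.

Lemma mu_Delta_seq s : setcomp I s -> Delta_seq s X != 0 ->
  isb (mprod R s I) /\ mu_seq I (Delta_seq s X) = mprod R s I.
Proof.
move=> /[dup] comp_s /and3P[_ ds /eqP cs]; rewrite -okseq_setcomp // => oks.
have bs := okseq_isb oks; split.
  by have := isb_mprod ds bs; rewrite cs.
have := @Delta_seq_restr s ds; rewrite cs restr_I.
move=> ->; rewrite ?cutable_I //; case/and4P: oks => _ _ _ ->.
exact: mu_seq_tens_seq.
Qed.

End Restriction.

End LinearizedHopf.

(** * The set C_x^y and the antipode coefficient *)

Section Antipode.
Variables (K : fieldType) (U : choiceType) (H : hopf_monoid K U).
Hypotheses (Hcomm : commutative_hopf H) (Hcocomm : cocommutative_hopf H).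
Hypothesis Hlin : linearized H.
Variables (I : {fset U}) (x y : basis H I).
Implicit Types (A B C J P Q S T : {fset U}) (s t : seq {fset U}).
Local Notation X := (<< x >> : {malg K[basis H I]}).
Local Notation R := (restr x).

Lemma mem_compset s : (s \in compset x y) =
  setcomp I s && ((Delta_seq s X != 0) && (mu_seq I (Delta_seq s X) == << y >>)).
Proof. by have := in_setcomps I s; rewrite !inE => ->. Qed.

Lemma compsetP s :
  reflect [/\ setcomp I s, okseq x s & mprod R s I = << y >>] (s \in compset x y).
Proof.
rewrite mem_compset; apply: (iffP and3P) => [[comp_s nz] | [comp_s ok_s fE]].
  have [_ ->] := mu_Delta_seq Hcocomm Hlin comp_s nz.
  by move/eqP=> fE; rewrite okseq_setcomp.
have nz : Delta_seq s X != 0 by rewrite -okseq_setcomp.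
by split=> //; have [_ ->] := mu_Delta_seq Hcocomm Hlin comp_s nz; apply/eqP.
Qed.

Lemma mu_seq0 s J : mu_seq J (0 : {malg K[basis_seq H s]}) = 0.
Proof. by case: s => [|A s] /=; rewrite ?mcoeff0 ?scale0r // tmap0 raddf0. Qed.

(** Each term of the antipode is, up to sign, zero or a single basis element, so it contributes its
    sign exactly when that element is [y]. *)
Lemma antipode_coef : (antipode X)@_y = (coef x y)%:~R.
Proof.
have compE : compset x y =
    [fset s in setcomps I | (Delta_seq s X != 0) &&
                            (mu_seq I (Delta_seq s X) == << y >>)] by [].
rewrite /antipode raddf_sum /coef rmorph_sum compE.
rewrite [RHS]big_fset [RHS]big_mkcond; apply: eq_big_seq => s.
rewrite in_setcomps /= mcoeffZ => comp_s.
have [Ds|nz] /= := eqVneq (Delta_seq s X) 0; first by rewrite Ds mu_seq0 mcoeff0 mulr0.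
have [[z zE] ->] := mu_Delta_seq Hcocomm Hlin comp_s nz.
rewrite zE mcoeffU; case: eqVneq => [->|zy].
  by rewrite eqxx mulr1 rmorphXn rmorphN1.
by case: eqP => [/malgU1_inj/eqP|_]; rewrite ?(negPf zy) // mulr0.
Qed.

Lemma mu_ACA J P Q S T A B C E (a : {malg K[basis H A]}) (b : {malg K[basis H B]})
    (c : {malg K[basis H C]}) (e : {malg K[basis H E]}) :
  decomp J P Q -> decomp P A B -> decomp Q C E ->
  decomp J S T -> decomp S A C -> decomp T B E ->
  mu H J P Q (tens (mu H P A B (tens a b)) (mu H Q C E (tens c e))) =
  mu H J S T (tens (mu H S A C (tens a c)) (mu H T B E (tens b e))).
Proof.
move=> dJ dP dQ dJ' dS dT.
have dBC : decomp (B `|` C) B C by fset_solve.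
have dCB : decomp (B `|` C) C B by fset_solve.
have dBQ : decomp (B `|` Q) B Q by fset_solve.
have dCT : decomp (B `|` Q) C T by fset_solve.
have dE : decomp (B `|` Q) (B `|` C) E by fset_solve.
have dA : decomp J A (B `|` Q) by fset_solve.
rewrite (mu_assoc _ _ _ dP dJ dBQ dA) -(mu_assoc _ _ _ dBC dE dQ dBQ).
by rewrite (Hcomm _ _ dBC) (mu_assoc _ _ _ dCB dE dT dCT) -(mu_assoc _ _ _ dS dJ' dCT dA).
Qed.

(** Commutativity and cocommutativity allow the part [A] to be moved to the front, which exhibits
    x_s as a product with left factor x_A. *)
Lemma mprod_front s A : okseq x s -> cup s = I -> A \in s ->
  [/\ okseq x (A :: rem A s), cup (rem A s) = I `\` A, isb (R A),
      isb (mprod R (rem A s) (I `\` A)) &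
      mprod R s I = mu H I A (I `\` A) (tens (R A) (mprod R (rem A s) (I `\` A)))].
Proof.
move=> oks cs As; have sA := perm_to_rem As.
have okA : okseq x (A :: rem A s) by rewrite -(okseq_perm Hcocomm Hlin x sA).
have dA : pdisj (A :: rem A s) by case/and4P: okA.
have cA : cup (A :: rem A s) = I by rewrite -(cup_perm sA).
have crem : cup (rem A s) = I `\` A.
  by have := pdisj_decomp dA; rewrite cA => dI; fset_solve.
have ds : pdisj s by case/and4P: oks.
split=> //; first exact: (okseq_isb Hcocomm Hlin oks).
  rewrite -crem; apply: isb_mprod => //.
    by move: dA; rewrite pdisj_cons => /andP[].
  have [okr _] := okseq_behead Hcocomm Hlin okA.
  exact: (okseq_isb Hcocomm Hlin okr).
by have := mprod_perm Hcomm R sA ds; rewrite cs => ->; rewrite /= crem.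
Qed.

Lemma setcomp_cup s : setcomp I s -> cup s = I.
Proof. by case/and3P=> _ _ /eqP. Qed.

(** * C_x^y in terms of a minimal composition *)

Section Minimal.
Variable L : seq {fset U}.
Hypothesis Lmin : minimal_comp x y L.

Let compL : setcomp I L. Proof. by have /compsetP[] := Lmin.1. Qed.
Let okL : okseq x L. Proof. by have /compsetP[] := Lmin.1. Qed.
Let fL : mprod R L I = << y >>. Proof. by have /compsetP[] := Lmin.1. Qed.
Let cL : cup L = I. Proof. exact: setcomp_cup. Qed.

(* Cutting y = x_s along P in s, and then regrouping along S in L, shows that *)
(* x_S is the product of its restrictions to S :&: P and S :\: P.             *)
Lemma restr_cut s S P : s \in compset x y -> P \in s -> S \in L ->
  let S1 := S `&` P in let S2 := S `\` P in
  Delta H S S1 S2 (R S) != 0 /\ R S = mu H S S1 S2 (tens (R S1) (R S2)).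
Proof.
case/compsetP=> comps oks fs Ps SL S1 S2.
have [okS cS bS bw SE] := mprod_front okL cL SL.
have [okP cP bP bz PE] := mprod_front oks (setcomp_cup comps) Ps.
move: bw bz SE PE; set w := mprod R _ _; set z := mprod R _ _ => bw bz SE PE.
rewrite fL in SE; rewrite fs in PE.
have [sSI sPI] : S `<=` I /\ P `<=` I.
  by split; [rewrite -cL | rewrite -(setcomp_cup comps)]; apply: mem_sub_cup.
pose T := I `\` S; pose Q := I `\` P; pose T1 := T `&` P; pose T2 := T `&` Q.
have dST : decomp I S T by rewrite /T; fset_solve.
have dPQ : decomp I P Q by rewrite /Q; fset_solve.
have dS : decomp S S1 S2 by rewrite /S1 /S2; fset_solve.
have dT : decomp T T1 T2 by rewrite /T1 /T2 /Q /T; fset_solve.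
have dP : decomp P S1 T1 by rewrite /T1 /S1 /T; fset_solve.
have dQ : decomp Q S2 T2 by rewrite /T2 /S2 /T /Q; fset_solve.
have cutS : cutable x S by have [_] := okseq_behead Hcocomm Hlin okS.
have DY : Delta H I P Q << y >> = tens (R P) z by rewrite PE Delta_muK.
have nzDY : Delta H I P Q << y >> != 0 by rewrite DY; apply/isb_neq0/isb_tens.
have S2E : S2 = S `&` Q by rewrite /S2 /Q; fset_solve.
have compat := mu_Delta_compat (R S) w dST dPQ.
have nzS : Delta H S S1 S2 (R S) != 0.
  apply: contra nzDY => /eqP DS; rewrite SE compat -S2E DS tens0l.
  by rewrite /tswap_mid linext0 tmap0.
have [DT|[t1 [t2 [bt1 bt2 DT]]]] := Delta_isb Hlin dT bw.
  by case/eqP: nzDY; rewrite SE compat DT tens0 /tswap_mid linext0 tmap0.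
have [c1 c2 DS] := restr_Delta Hcocomm Hlin sSI dS cutS nzS.
have b1 : isb (R S1) by apply: (isb_restr Hcocomm Hlin) => //; rewrite /S1; fset_solve.
have b2 : isb (R S2) by apply: (isb_restr Hcocomm Hlin) => //; rewrite /S2; fset_solve.
have := Delta_mu_tens dST dPQ dS dT dP dQ b1 b2 bt1 bt2 DS DT.
rewrite -SE DY => /tens_inj[] //; try exact: isb_mu.
move=> PE' zE; split=> //; move: SE.
rewrite PE PE' zE (mu_ACA _ _ _ _ dPQ dP dQ dST dS dT).
by case/(mu_tens_inj Hcocomm Hlin dST) => //; try exact: isb_mu.
Qed.

(** Otherwise, by [restr_cut], replacing [S] in [L] by its intersection and difference with [P]
    yields a strictly finer member of C_x^y, against minimality. *)
Lemma part_sub_or_disjoint s S P : s \in compset x y -> P \in s -> S \in L ->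
  (S `<=` P) || [disjoint S & P]%fset.
Proof.
move=> sC Ps SL; apply: contraT; rewrite negb_or => /andP[nsub ndisj].
have [nzS SE] := restr_cut sC Ps SL.
set S1 := S `&` P in nzS SE; set S2 := S `\` P in nzS SE.
have [L1 [L2 LE]] : exists L1 L2, L = L1 ++ S :: L2.
  by case: (splitPr SL) => L1 L2; exists L1, L2.
have SE12 : S1 `|` S2 = S by rewrite /S1 /S2; fset_solve.
have dS : decomp S S1 S2 by rewrite /S1 /S2; fset_solve.
have permL : perm_eq L (S :: L1 ++ L2).
  by rewrite LE -(cat1s S L2) -(cat1s S (L1 ++ L2)) perm_catCA.
pose L' := L1 ++ [:: S1, S2 & L2].
have permL' : perm_eq L' [:: S1, S2 & L1 ++ L2].
  exact: (permEl (perm_catCA L1 [:: S1; S2] L2)).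
have okL' : okseq x L'.
  rewrite (okseq_perm Hcocomm Hlin x permL') okseq_merge // SE12 nzS.
  rewrite -(okseq_perm Hcocomm Hlin x permL) okL /= andbT.
  by rewrite /S1 /S2; fset_solve.
have cL' : cup L' = I.
  by rewrite (cup_perm permL') !cup_cons fsetUA SE12 -cup_cons -(cup_perm permL).
have dL' : pdisj L' by case/and4P: okL'.
suff L'C : L' \in compset x y.
  have refL : refines L' L.
    (* Every stretch is a single part, except the two pieces of [S]. *)
    exists ([seq [:: A] | A <- L1] ++ [:: S1; S2] :: [seq [:: A] | A <- L2]).
    have idE M : [seq cup t | t <- [seq [:: A] | A <- M]] = M.
      by elim: M => //= A M ->; rewrite cup_cons cup_nil fsetU0.
    rewrite flatten_cat /= map_cat /= !flatten_seq1 !idE.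
    by rewrite !cup_cons cup_nil fsetU0 SE12 LE.
  have := congr1 size (Lmin.2 L' L'C refL).
  by rewrite LE !size_cat /= => /addnI[] /esym/n_Sn.
apply/compsetP; split=> //.
  apply/and3P; split=> //; last by rewrite cL'.
  have /and3P[nzL _ _] := compL; move: nzL; rewrite LE !all_cat /=.
  case/and3P=> -> _ ->; rewrite andbT /= fsetI_eq0 ndisj.
  by rewrite fsetD_eq0 nsub.
have := mprod_perm Hcomm R permL' dL'; rewrite cL' => ->.
have dL : pdisj L by case/and4P: okL.
have := mprod_perm Hcomm R permL dL; rewrite cL fL => ->.
have dSt : pdisj (S :: L1 ++ L2) by rewrite -(pdisj_perm permL).
have dI : decomp I S (cup (L1 ++ L2)).
  by have := pdisj_decomp dSt; rewrite -(cup_perm permL) cL.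
have d2 : decomp (cup (S2 :: L1 ++ L2)) S2 (cup (L1 ++ L2)).
  by rewrite cup_cons; fset_solve.
have d1 : decomp I S1 (cup (S2 :: L1 ++ L2)) by rewrite cup_cons; fset_solve.
(* Regrouping the factors at [S1] and [S2] restores x_S by [SE], so the refined product is still
   [y]. *)
by rewrite [LHS](esym (mu_assoc _ _ _ dS dI d2 d1)) -SE.
Qed.

Local Notation V := 'I_(size L).
Implicit Types (W : {set V}).
Local Notation lam W := (cup (parts W)).

Lemma partsE W : parts W = [seq nth fset0 L i | i : V <- enum W].
Proof. by []. Qed.

Lemma parts_setU W W' : [disjoint W & W']%B ->
  perm_eq (parts (W :|: W')) (parts W ++ parts W').
Proof.
move=> dW; rewrite !partsE -map_cat; apply: perm_map; apply: uniq_perm.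
- exact: enum_uniq.
- rewrite cat_uniq !enum_uniq andbT /=; apply/hasPn=> i; rewrite !mem_enum.
  by move=> iW'; rewrite (disjointFl dW).
- by move=> i; rewrite mem_cat !mem_enum inE.
Qed.

Lemma parts_setT : parts [set: V] = L.
Proof.
rewrite partsE enum_setT -enumT; apply: (@eq_from_nth _ fset0).
  by rewrite size_map size_enum_ord.
move=> i; rewrite size_map size_enum_ord => iL.
by rewrite (nth_map (Ordinal iL)) ?size_enum_ord // nth_enum_ord.
Qed.

Lemma flatten_parts W (B : seq {set V}) : scomp W B ->
  perm_eq (flatten [seq parts W' | W' <- B]) (parts W).
Proof.
elim: B W => [|D B IHB] W /=.
  by move/eqP->; rewrite partsE enum_set0.
case/and3P=> _ sDW /IHB BE.
have dD : [disjoint D & W :\: D]%B by rewrite disjoints_subset setCD subsetUr.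
have WE : D :|: (W :\: D) = W.
  by apply/setP=> i; rewrite !inE; have [/(subsetP sDW)|] := boolP (i \in D).
by rewrite -[in parts W]WE perm_sym (permPl (parts_setU dD)) perm_cat2l perm_sym.
Qed.

(** The parts indexed by [W] form a suffix of a reordering of [L]. *)
Lemma okseq_parts W : okseq x (parts W).
Proof.
have permW : perm_eq (parts (~: W) ++ parts W) L.
  have dW : [disjoint ~: W & W]%B by rewrite disjoints_subset.
  by have := parts_setU dW; rewrite setUC setUCr parts_setT perm_sym.
have : okseq x (parts (~: W) ++ parts W) by rewrite (okseq_perm Hcocomm Hlin x permW).
by elim: (parts (~: W)) => //= A s IHs /(okseq_behead Hcocomm Hlin)[/IHs].
Qed.

Lemma lam_sub W : lam W `<=` I.
Proof. by case/and4P: (okseq_parts W). Qed.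

Lemma isb_restr_lam W : isb (R (lam W)).
Proof. by case/and4P: (okseq_parts W) => *; apply: isb_restr. Qed.

Lemma isb_mprod_parts W : isb (mprod R (parts W) (lam W)).
Proof.
apply: isb_mprod => //; first by case/and4P: (okseq_parts W).
exact: (okseq_isb Hcocomm Hlin (okseq_parts W)).
Qed.

Lemma splitsE W : splits x W = (mprod R (parts W) (lam W) == R (lam W)).
Proof.
by rewrite /splits mu_seq_tens_seq //; apply: (okseq_isb Hcocomm Hlin (okseq_parts W)).
Qed.

Lemma splits0 : splits x (set0 : {set V}).
Proof.
rewrite splitsE partsE enum_set0 /= cup_nil.
have := isb_restr_lam set0; rewrite partsE enum_set0 /= cup_nil => b0.
by have [_ ->] := hcounit_isb Hlin b0.
Qed.

(** If x splits on [W], cutting x at [W'] can be computed from the product over [W], by [Delta_muK],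
    or as a restriction, by [restr_Delta]; comparing left factors gives splitting on [W']. *)
Lemma splits_sub W W' : W' \subset W -> splits x W -> splits x W'.
Proof.
move=> sW; rewrite !splitsE; pose W2 := W :\: W'.
have dW : [disjoint W' & W2]%B by rewrite disjoints_subset setCD subsetUr.
have WE : W' :|: W2 = W.
  by apply/setP=> i; rewrite !inE; have [/(subsetP sW)|] := boolP (i \in W').
have := parts_setU dW; rewrite WE => permW.
have dpW : pdisj (parts W) by case/and4P: (okseq_parts W).
have dcat : pdisj (parts W' ++ parts W2) by rewrite -(pdisj_perm permW).
have dJ : decomp (lam W) (lam W') (lam W2).
  move: dcat; rewrite pdisj_cat => /and3P[dc _ _].
  by rewrite /decomp dc andbT (cup_perm permW) cup_cat.
rewrite (mprod_perm Hcomm R permW dpW).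
have := mprod_cat R dcat; rewrite -(cup_perm permW) => -> /eqP fE.
have := Delta_muK Hcocomm Hlin dJ (isb_mprod_parts W') (isb_mprod_parts W2).
rewrite fE => DE.
have nz : Delta H (lam W) (lam W') (lam W2) (R (lam W)) != 0.
  by rewrite DE; apply/isb_neq0/isb_tens; apply: isb_mprod_parts.
have cW : cutable x (lam W) by case/and4P: (okseq_parts W).
have [_ _] := restr_Delta Hcocomm Hlin (lam_sub W) dJ cW nz.
rewrite DE => /tens_inj[] // => [||||-> _ //].
- exact: isb_mprod_parts.
- exact: isb_mprod_parts.
- exact: isb_restr_lam.
- exact: isb_restr_lam.
Qed.

(** Splitting is hereditary, so failure to split is witnessed by a minimal failing subset, which is
    a hyperedge. *)
Lemma splitsP W :
  splits x W = [forall E in hyperedges x L, ~~ (E \subset W)].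
Proof.
apply/idP/forall_inP => [spW E | noE].
  rewrite inE => /andP[nspE _]; apply: contra nspE => sE.
  exact: splits_sub spW.
apply: contraT => nspW.
have [E /minsetP[nspE minE] sEW] := @minset_exists _ (fun E => ~~ splits x E) W nspW.
have /negP[] : ~~ (E \subset W).
  apply: noE; rewrite inE nspE; apply/forall_inP=> P /andP[_ pP].
  apply: contraT => nspP; have := minE P nspP (proper_sub pP) => PE.
  by rewrite PE properxx in pP.
exact: sEW.
Qed.

(** Products of basis elements over a fixed decomposition determine their factors, so the two
    products agree iff they agree block by block. *)
Lemma mprod_lam (B : seq {set V}) : okseq x (flatten [seq parts W | W <- B]) ->
  let s := [seq lam W | W <- B] in
  (mprod R s (cup s) == mprod R (flatten [seq parts W | W <- B]) (cup s)) =
  all (fun W => splits x W) B.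
Proof.
elim: B => [|W B IHB] okB s; first by rewrite eqxx.
rewrite /s /= {s}; set s := [seq _ | W <- B]; set t := flatten _.
have ct : cup t = cup s by rewrite cup_flatten -map_comp.
have okt : okseq x t.
  move: okB; rewrite /= -/t; elim: (parts W) => //= A r IHr.
  by case/(okseq_behead Hcocomm Hlin)=> /IHr.
have oks : okseq x s by have := okseq_flatten Hcocomm Hlin okt; rewrite -map_comp.
have dcat : pdisj (parts W ++ t) by case/and4P: okB.
have := mprod_cat R dcat; rewrite cup_cat ct -cup_cons => ->.
have dJ : decomp (cup (lam W :: s)) (lam W) (cup s).
  move: dcat; rewrite pdisj_cat ct => /and3P[dc _ _].
  by rewrite /decomp cup_cons eqxx.
have bs : isb (mprod R s (cup s)).
  apply: isb_mprod => //; first by case/and4P: oks.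
  exact: (okseq_isb Hcocomm Hlin oks).
have bt : isb (mprod R t (cup s)).
  rewrite -ct; apply: isb_mprod => //; first by case/and4P: okt.
  exact: (okseq_isb Hcocomm Hlin okt).
rewrite splitsE -IHB // -/s -/t; apply/eqP/andP => [E | [/eqP-> /eqP<-] //].
have [-> ->] := mu_tens_inj Hcocomm Hlin dJ (isb_restr_lam W) bs (isb_mprod_parts W) bt E.
by rewrite !eqxx.
Qed.

Lemma lam_inj : injective (fun W => lam W).
Proof.
suff lamE W : W = [set i : V | nth fset0 L i `<=` lam W].
  by move=> W W' /= lamWW'; rewrite (lamE W) lamWW' -lamE.
apply/setP=> i; rewrite inE; apply/idP/idP => [iW | /fsubsetP si].
  by apply: mem_sub_cup; apply/mapP; exists i; rewrite ?mem_enum.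
have /and3P[/allP nzL /(pairwiseP fset0) dL _] := compL.
have /fset0Pn[u ui] : nth fset0 L i != fset0 by apply/nzL/mem_nth.
have /cupP[_ /mapP[j + ->] uj] := si u ui; rewrite mem_enum => jW.
suff -> : i = j by [].
apply/val_inj/eqP; rewrite eqn_leq /=; apply/andP; split; rewrite leqNgt; apply/negP=> lt.
  by have /fdisjointP/(_ u uj)/negP := dL _ _ (ltn_ord j) (ltn_ord i) lt.
by have /fdisjointP/(_ u ui)/negP := dL _ _ (ltn_ord i) (ltn_ord j) lt.
Qed.

(** Gluing the parts of [L] along the blocks of a composition of V always keeps the coproduct
    nonzero; the product is still [y] exactly when x splits on each block. Every member of C_x^y
    arises in this way by [part_sub_or_disjoint]. *)
Lemma compset_scomps : perm_eq (compset x y)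
  [seq [seq lam W | W <- M] | M <- scomps [set: V] & all (fun W => splits x W) M].
Proof.
apply: uniq_perm; first exact: fset_uniq.
  rewrite map_inj_uniq ?filter_uniq ?scomps_uniq //.
  exact/inj_map/lam_inj.
have compB (B : seq {set V}) : scomp [set: V] B -> perm_eq (flatten [seq parts W | W <- B]) L.
  by move/flatten_parts; rewrite parts_setT.
have compBC (B : seq {set V}) : scomp [set: V] B ->
    ([seq lam W | W <- B] \in compset x y) = all (fun W => splits x W) B.
  move=> sB; have pB := compB B sB.
  have okf : okseq x (flatten [seq parts W | W <- B]).
    by rewrite (okseq_perm Hcocomm Hlin x pB).
  have oks : okseq x [seq lam W | W <- B].
    by have := okseq_flatten Hcocomm Hlin okf; rewrite -map_comp.
  have cI : cup [seq lam W | W <- B] = I.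
    by rewrite -cL -(cup_perm pB) cup_flatten -map_comp.
  rewrite -mprod_lam // cI.
  have df : pdisj (flatten [seq parts W | W <- B]) by case/and4P: okf.
  have := mprod_perm Hcomm R pB df; rewrite (cup_perm pB) cL fL => ->.
  apply/compsetP/eqP=> [[]//|fE]; split=> //.
  apply/and3P; split; [|by case/and4P: oks | by rewrite cI].
  apply/allP=> _ /mapP[W WB ->].
  move: sB; rewrite scompE => /and3P[/allP/(_ W WB)/set0Pn[i iW] _ _].
  have /and3P[/allP nzL _ _] := compL.
  have := nzL _ (mem_nth fset0 (ltn_ord i)); apply: contraNN => /eqP lam0.
  suff : nth fset0 L i `<=` lam W by rewrite lam0 fsubset0.
  by apply: mem_sub_cup; apply/mapP; exists i; rewrite ?mem_enum.
move=> s; apply/idP/mapP => [sC | [B]]; last first.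
  by rewrite mem_filter mem_scomps => /andP[spB sB] ->; rewrite compBC.
(* The inverse correspondence: the indices of the parts of [L] contained in [P]. *)
pose blk P : {set V} := [set i : V | nth fset0 L i `<=` P].
have lamK P : P \in s -> lam (blk P) = P.
  move=> Ps; apply/fsetP=> u; apply/cupP/idP => [[_ /mapP[i + ->]] | uP].
    by rewrite mem_enum inE => /fsubsetP si /si.
  have : u \in cup L.
    rewrite cL -(@setcomp_cup s); last by case/compsetP: sC.
    by apply/cupP; exists P.
  case/cupP=> A AL uA; exists A => //.
  have iL : (index A L < size L)%N by rewrite index_mem.
  apply/mapP; exists (Ordinal iL); rewrite /= ?nth_index // mem_enum inE /= nth_index //.
  case/orP: (part_sub_or_disjoint sC Ps AL) => // /fdisjointP/(_ u uA).
  by rewrite uP.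
have sE : s = [seq lam W | W <- [seq blk P | P <- s]].
  by rewrite -map_comp -[LHS]map_id; apply/eq_in_map=> P /lamK /= ->.
have sB : scomp [set: V] [seq blk P | P <- s].
  have /compsetP[/and3P[/allP nzs ds /eqP cs] _ _] := sC.
  rewrite scompE; apply/and3P; split.
  - rewrite all_map; apply/allP=> P Ps /=; apply: contraNneq (nzs P Ps) => blk0.
    by rewrite -(lamK P Ps) blk0 partsE enum_set0 /= cup_nil.
  - rewrite pairwise_map; apply: (@sub_in_pairwise _ (mem s)) ds;
      last exact/allP.
    move=> P Q Ps Qs /= dPQ.
    rewrite disjoints_subset; apply/subsetP=> i; rewrite !inE => /fsubsetP iP.
    have /and3P[/allP nzL _ _] := compL.
    have /fset0Pn[u ui] := nzL _ (mem_nth fset0 (ltn_ord i)).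
    by apply/negP=> /fsubsetP/(_ u ui); apply/negP; apply: (fdisjointP dPQ); apply: iP.
  - rewrite -subTset; apply/subsetP=> i _.
    have /and3P[/allP nzL _ _] := compL.
    have /fset0Pn[u ui] := nzL _ (mem_nth fset0 (ltn_ord i)).
    have : u \in cup s.
      by rewrite cs -cL; apply/cupP; exists (nth fset0 L i) => //; apply: mem_nth.
    case/cupP=> P Ps uP; rewrite mem_bigcup_seq has_map; apply/hasP; exists P => //=.
    rewrite inE; case/orP: (part_sub_or_disjoint sC Ps (mem_nth fset0 (ltn_ord i))) => //.
    by move/fdisjointP/(_ u ui); rewrite uP.
exists [seq blk P | P <- s] => //.
by rewrite mem_filter mem_scomps sB andbT -compBC // -sE.
Qed.

Lemma coef_scomps : coef x y =
  \sum_(M <- scomps [set: V] | avoids (hyperedges x L) M) (-1) ^+ size M.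
Proof.
rewrite /coef (perm_big _ compset_scomps) big_map big_filter.
rewrite (eq_bigl (avoids (hyperedges x L))).
  by apply: eq_bigr => M _; rewrite size_map.
by move=> M; apply: eq_all => W; rewrite splitsP.
Qed.

Lemma set0_notin_hyperedges : set0 \notin hyperedges x L.
Proof. by rewrite inE splits0. Qed.

End Minimal.
End Antipode.

Theorem theorem3p14 (K : fieldType) (charK0 : [pchar K] =i pred0)
  (U : choiceType) (H : hopf_monoid K U)
  (Hcomm : commutative_hopf H) (Hcocomm : cocommutative_hopf H)
  (Hlin : linearized H)
  (I : {fset U}) (x y : basis H I) (Cxy_neq0 : compset x y != fset0)
  (Lam : seq {fset U}) (Lam_min : minimal_comp x y Lam) :
  (antipode << x >>)@_y = (coef x y)%:~R /\
  coef x y =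
    \sum_(O in acyclic_orientations (hyperedges x Lam)) (-1) ^+ size (comp_of O).
Proof.
split; first exact: antipode_coef.
rewrite (coef_scomps Hcomm Hcocomm Hlin Lam_min).
rewrite sum_acyclic_orientations //.
exact: (set0_notin_hyperedges Hcocomm Hlin Lam_min).
Qed.
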